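(* Let $\lambda>0$ and let $I: M_{\lambda}\to\mathbb{R}^3$ be a smooth embedded paper Moebius band of aspect ratio $\lambda$. Then $\lambda>\sqrt 3$.
   Context: For $\lambda>0$, $M_\lambda$ is the flat Moebius band $M_{\lambda}=([0,\lambda]\times[0,1])/\sim$ with $(0,y)\sim(\lambda,1-y)$, carrying the flat metric induced from the rectangle. A smooth paper Moebius band of aspect ratio $\lambda$ is an infinitely differentiable isometric mapping $I:M_\lambda\to\mathbb{R}^3$, i.e. a $C^\infty$ map preserving arc-lengths of curves. Smoothness at the boundary means that $I$ extends smoothly to an open neighborhood of each boundary point in a slightly larger open Moebius band. The band is called embedded if $I$ is injective. *)

(* Defs.v *)
From HB Require Import structures.
From mathcomp Require Import all_boot all_order all_algebra.
From mathcomp Require Import all_classical all_reals all_analysis.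
Set Implicit Arguments. Unset Strict Implicit. Unset Printing Implicit Defensive.
Import Order.TTheory GRing.Theory Num.Theory.
Import numFieldNormedType.Exports.
Local Open Scope classical_set_scope.
Local Open Scope ring_scope.

Definition e1 {R : realType} : R * R := (1, 0).
Definition e2 {R : realType} : R * R := (0, 1).

Fixpoint Ck {R : realType} {V : normedModType R} (U : set (R * R)) (k : nat)
    (f : R * R -> V) : Prop :=
  match k with
  | 0 => forall p, U p -> {for p, continuous f}
  | k'.+1 => (forall p, U p -> {for p, continuous f}) /\
             (forall p, U p -> derivable f p e1 /\ derivable f p e2) /\
             Ck U k' ('D_e1 f) /\ Ck U k' ('D_e2 f)
  end.

Definition smooth_on {R : realType} {V : normedModType R} (U : set (R * R))
    (f : R * R -> V) : Prop := forall k, Ck U k f.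

Definition dot3 {R : realType} (u v : 'rV[R]_3) : R := \sum_(i < 3) u 0 i * v 0 i.

(* The closed strip R x [0,1], the universal-type cover of M_lambda. *)
Definition strip {R : realType} : set (R * R) := [set p | 0 <= p.2 <= 1].

(* The identification defining M_lambda, lifted to the strip:
   (x,y) ~ (x + k lambda, y) for k even, (x + k lambda, 1 - y) for k odd. *)
Definition moeb_rel {R : realType} (lam : R) (p q : R * R) : Prop :=
  exists k : int, q.1 = p.1 + k%:~R * lam /\
                  q.2 = (if odd `|k|%N then 1 - p.2 else p.2).

(* A smooth paper Moebius band of aspect ratio lam, given by its lift
   G : strip -> R^3 (values off the strip are irrelevant):
   - G respects the gluing (0,y) ~ (lam,1-y), i.e. G(x+lam,y) = G(x,1-y);
   - near every point of the closed strip (boundary points included), G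
     coincides on the strip with a C^infinity map H defined on an open
     neighborhood in the plane (i.e. in a slightly larger open band);
   - G is isometric for the flat metric: the first fundamental form of H
     at every point of the strip is the identity. *)
Definition smooth_paper_moebius {R : realType} (lam : R)
    (G : R * R -> 'rV[R]_3) : Prop :=
  (forall x y, 0 <= y <= 1 -> G (x + lam, y) = G (x, 1 - y)) /\
  (forall p, strip p ->
     exists (V : set (R * R)) (H : R * R -> 'rV[R]_3),
       [/\ open V, V p, smooth_on V H,
           (forall q, V q -> strip q -> H q = G q) &
           (forall q, V q -> strip q ->
              [/\ dot3 ('D_e1 H q) ('D_e1 H q) = 1,
                  dot3 ('D_e2 H q) ('D_e2 H q) = 1 &
                  dot3 ('D_e1 H q) ('D_e2 H q) = 0])]).

Definition moeb_embedded {R : realType} (lam : R) (G : R * R -> 'rV[R]_3) : Prop :=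
  forall p q, strip p -> strip q -> G p = G q -> moeb_rel lam p q.

(* Main.v *)
Require Import Defs.
From HB Require Import structures.
From mathcomp Require Import all_boot all_order all_algebra.
From mathcomp Require Import all_classical all_reals all_analysis.
From mathcomp Require Import ring lra.
Import Order.TTheory GRing.Theory Num.Theory.
Import numFieldNormedType.Exports.
Set Implicit Arguments. Unset Strict Implicit. Unset Printing Implicit Defensive.
Local Open Scope classical_set_scope.
Local Open Scope ring_scope.

(** The second fundamental form of a flat surface has vanishing determinant and
    satisfies the Codazzi equations.  Along a straight line of the strip that
    starts in a null direction of the form at a point where it is nonzero, these
    equations become linear ODEs showing that the direction remains null and
    that the form does not vanish, so the line runs to both boundary components
    and is mapped to a straight segment (a bend).  Bends through points of
    nonzero curvature do not cross; hence, in terms of the abscissa of their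
    midpoint, their inverse slope is 2-Lipschitz.  Every 2-Lipschitz extension of
    it gives bends through all points of the centre line, because a segment of
    the extended family meets no curved point unless it is a bend already.

    Let [u x] be the vector of the image of the bend at [x] and [m x] its
    midpoint.  The functions [u x . u y] and [(m x - m y) . (u x * u y)] are
    symmetric, change sign under [y -> y + lam], and on the diagonal the first is
    positive and the second zero.  By the Borsuk-Ulam argument (Tucker's lemma on
    a grid) they have a common zero: two coplanar bends in perpendicular lines.
    By embeddedness the two segments do not cross, so one of them lies on one side
    of the line of the other, which has length [sqrt (1 + t ^ 2)].  Comparing both
    boundary arcs with the perimeters of triangles gives
    [(lam + t) ^ 2 >= 5 + t ^ 2] and [(lam - t) ^ 2 >= 1 + t ^ 2], not both
    with equality, and adding these gives [lam ^ 2 > 3]. *)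

(** * Directional derivatives of smooth functions *)

Section PointwiseRules.
Context {R : realType} {V : normedModType R}.
Implicit Types (f g : V -> R) (x v : V).

Lemma is_derive_lin (a b : R) f g x v df dg : is_derive x v f df -> is_derive x v g dg ->
  is_derive x v (fun p => a * f p + b * g p) (a * df + b * dg).
Proof.
move=> fd gd.
exact: (is_deriveD (is_deriveZ a fd) (is_deriveZ b gd)).
Qed.

Lemma is_derive_mul f g x v df dg : is_derive x v f df -> is_derive x v g dg ->
  is_derive x v (fun p => f p * g p) (f x * dg + g x * df).
Proof. by move=> fd gd; exact: (is_deriveM fd gd). Qed.

End PointwiseRules.

(** The map [s] carries the line through [q] in direction [u] to the line through [s q] in direction
    [u'] with the same parameter, so the two difference quotients coincide. *)
Lemma is_derive_affine {R : realType} {V V' : normedModType R} (f : V' -> R) (s : V -> V')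
    q u u' df : (forall h : R, s (h *: u + q) = h *: u' + s q) ->
  is_derive (s q) u' f df -> is_derive q u (fun x => f (s x)) df.
Proof.
move=> sE [fd <-].
have E : (fun h : R => h^-1 *: (((fun x => f (s x)) \o shift q) (h *: u) - f (s q))) =
    (fun h => h^-1 *: ((f \o shift (s q)) (h *: u') - f (s q))).
  by apply/funext => h /=; rewrite sE.
by split; rewrite /derivable /derive E.
Qed.

Section Calculus.
Context {R : realType}.
Implicit Types (f g : R * R -> R) (p q v u : R * R) (U : set (R * R)).

Lemma pair_ext p q : p.1 = q.1 -> p.2 = q.2 -> p = q.
Proof. by case: p q => [a b] [c d] /= -> ->. Qed.

Lemma derive_line f p v s : derivable f (s *: v + p) v ->
  is_derive s (1 : R) (fun s => f (s *: v + p)) ('D_v f (s *: v + p)).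
Proof.
move=> df; apply: (@is_derive_affine R R^o (R * R)%type f (fun s : R => s *: v + p) s 1 v _ _ (derivableP df)).
by move=> h; rewrite scaler1 scalerDl addrA.
Qed.

Lemma near_eq_open {V : normedModType R} U (f g : R * R -> V) p : open U ->
  (forall p, U p -> f p = g p) -> U p -> \near p, f p = g p.
Proof. by move=> oU fg Up; apply: filterS (open_nbhs_nbhs (conj oU Up)) => q /fg. Qed.

Lemma continuous_ext {V : normedModType R} U (f g : R * R -> V) p : open U ->
  (forall p, U p -> f p = g p) -> U p -> {for p, continuous f} -> {for p, continuous g}.
Proof.
move=> oU fg Up cf; have : g @ p --> f p.
  apply: cvg_trans cf; apply: near_eq_cvg.
  exact: (near_eq_open oU fg Up).
by rewrite (fg _ Up).
Qed.

Lemma Ck_ext {V : normedModType R} U k (f g : R * R -> V) : open U ->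
  (forall p, U p -> f p = g p) -> Ck U k f -> Ck U k g.
Proof.
move=> oU; elim: k f g => [|k IH] f g fg /=.
  by move=> cf p Up; apply: (continuous_ext oU fg Up); apply: cf.
move=> [cf [df [d1 d2]]]; split; [|split; [|split]].
- by move=> p Up; apply: (continuous_ext oU fg Up); apply: cf.
- move=> p Up; have [? ?] := df p Up; have nfg := near_eq_open oU fg Up.
  by split; apply: near_eq_derivable nfg _.
- by apply: IH d1 => p Up; apply: near_eq_derive (near_eq_open oU fg Up).
- by apply: IH d2 => p Up; apply: near_eq_derive (near_eq_open oU fg Up).
Qed.

(** [Ck] consists of pointwise conditions on functions defined on the whole plane, so [W] need not
    be open. *)
Lemma Ck_local {V : normedModType R} U k (f : R * R -> V) :
  (forall p, U p -> exists W, W p /\ Ck W k f) -> Ck U k f.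
Proof.
elim: k f => [|k IH] f /= H.
  by move=> p /H[W [Wp]]; apply.
split; [|split; [|split]].
- by move=> p /H[W [Wp [cf _]]]; apply: cf.
- by move=> p /H[W [Wp [_ [df _]]]]; apply: df.
- by apply: IH => p /H[W [Wp [_ [_ [d _]]]]]; exists W.
- by apply: IH => p /H[W [Wp [_ [_ [_ d]]]]]; exists W.
Qed.

Lemma Ck_sub {V : normedModType R} U W k (f : R * R -> V) : W `<=` U ->
  Ck U k f -> Ck W k f.
Proof. by move=> WU Uf; apply: Ck_local => p /WU Up; exists U. Qed.

Lemma Ck_lin U k (a b : R) f g : open U -> Ck U k f -> Ck U k g ->
  Ck U k (fun p => a * f p + b * g p).
Proof.
have cl (h1 h2 : R * R -> R) p : {for p, continuous h1} -> {for p, continuous h2} ->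
    {for p, continuous (fun p => a * h1 p + b * h2 p)}.
  by move=> c1 c2; apply: cvgD; apply: cvgMr.
move=> oU; elim: k f g => [|k IH] f g /=.
  by move=> cf cg p Up; apply: cl; [apply: cf|apply: cg].
move=> [cf [df [f1 f2]]] [cg [dg [g1 g2]]].
have D p : U p -> is_derive p e1 (fun p => a * f p + b * g p) (a * 'D_e1 f p + b * 'D_e1 g p) /\
    is_derive p e2 (fun p => a * f p + b * g p) (a * 'D_e2 f p + b * 'D_e2 g p).
  by move=> Up; have [? ?] := df p Up; have [? ?] := dg p Up;
    split; apply: is_derive_lin; apply: derivableP.
split; [|split; [|split]].
- by move=> p Up; apply: cl; [apply: cf|apply: cg].
- by move=> p /D[[? _] [? _]].
- by apply: Ck_ext (IH _ _ f1 g1) => // p /D[[_ ->] _].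
- by apply: Ck_ext (IH _ _ f2 g2) => // p /D[_ [_ ->]].
Qed.

Lemma Ck_coord U k (f : R * R -> 'rV[R]_3) i : open U -> Ck U k f ->
  Ck U k (fun p => f p 0 i).
Proof.
have cc (h : R * R -> 'rV[R]_3) p : {for p, continuous h} -> {for p, continuous (fun p => h p 0 i)}.
  by move=> ch; exact: (continuous_comp ch (@coord_continuous _ _ _ 0 i (h p))).
move=> oU; elim: k f => [|k IH] f /=; first by move=> cf p Up; apply/cc/cf.
move=> [cf [df [f1 f2]]]; split; [|split; [|split]].
- by move=> p Up; apply/cc/cf.
- move=> p Up; have [d1 d2] := df p Up.
  by split; [move/derivable_mxP : d1|move/derivable_mxP : d2]; apply.
- have E p : U p -> 'D_e1 f p 0 i = 'D_e1 (fun p => f p 0 i) p.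
    by move=> /df[d1 d2]; have /(congr1 (fun M : 'rV[R]_3 => M 0 i)) := derive_mx d1; rewrite mxE.
  exact: (Ck_ext oU E (IH _ f1)).
- have E p : U p -> 'D_e2 f p 0 i = 'D_e2 (fun p => f p 0 i) p.
    by move=> /df[d1 d2]; have /(congr1 (fun M : 'rV[R]_3 => M 0 i)) := derive_mx d2; rewrite mxE.
  exact: (Ck_ext oU E (IH _ f2)).
Qed.

Lemma MVT_line f p v (t : R) : (forall s : R, `|s| <= `|t| -> derivable f (s *: v + p) v) ->
  exists2 s : R, `|s| <= `|t| & f (t *: v + p) - f p = t * 'D_v f (s *: v + p).
Proof.
move=> df.
have D (s : R) : `|s| <= `|t| -> is_derive s (1 : R) (fun s : R => f (s *: v + p)) ('D_v f (s *: v + p)).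
  by move=> /df; apply: derive_line.
have C (s : R) : `|s| <= `|t| -> {for s, continuous (fun s : R => f (s *: v + p))}.
  move=> /D [ds _]; exact: differentiable_continuous ((derivable1_diffP _ _).1 ds).
have f0 : f p = f (0 *: v + p) by rewrite scale0r add0r.
rewrite f0; have [t0|t0] := leP 0 t.
- have [s sI ->] : exists2 c, c \in `[0, t] &
      f (t *: v + p) - f (0 *: v + p) = 'D_v f (c *: v + p) * (t - 0).
    apply: (@MVT_segment _ (fun s : R => f (s *: v + p)) (fun s : R => 'D_v f (s *: v + p))) => //.
      move=> x; rewrite in_itv /= => /andP[x0 xt]; apply: D.
      by rewrite !ger0_norm // ltW.
    apply: continuous_in_subspaceT => x; rewrite inE /= in_itv /= => /andP[x0 xt]; apply: C.
    by rewrite !ger0_norm.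
  exists s; last by rewrite subr0 mulrC.
  by move: sI; rewrite in_itv /= => /andP[x0 xt]; rewrite !ger0_norm.
- have [s sI E] : exists2 c, c \in `[t, 0] &
      f (0 *: v + p) - f (t *: v + p) = 'D_v f (c *: v + p) * (0 - t).
    apply: (@MVT_segment _ (fun s : R => f (s *: v + p)) (fun s : R => 'D_v f (s *: v + p))) => //.
      exact: ltW.
      move=> x; rewrite in_itv /= => /andP[x0 xt]; apply: D.
      by rewrite !ler0_norm ?lerN2 // ltW.
    apply: continuous_in_subspaceT => x; rewrite inE /= in_itv /= => /andP[x0 xt]; apply: C.
    by rewrite !ler0_norm ?lerN2 // ltW.
  exists s; last by rewrite -opprB E; ring.
  by move: sI; rewrite in_itv /= => /andP[x0 xt]; rewrite !ler0_norm ?lerN2// ltW.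
Qed.

Lemma nbhs_box p (P : set (R * R)) : nbhs p P ->
  exists2 d : R, 0 < d & forall q, `|q.1 - p.1| < d -> `|q.2 - p.2| < d -> P q.
Proof.
move=> /nbhs_ballP[d /= d0 dP]; exists d => // q q1 q2.
by apply: dP; split; rewrite -ball_normE /= distrC.
Qed.

(** The increment along [h *: v] splits into a horizontal and a vertical step; the mean value
    theorem on each leaves partial derivatives at points near [p], and these are continuous. *)
Lemma is_derive_dir U f p v : open U -> Ck U 1 f -> U p ->
  is_derive p v f (v.1 * 'D_e1 f p + v.2 * 'D_e2 f p).
Proof.
move=> oU [cf [df [c1 c2]]] Up.
suff C : (fun h : R => h^-1 *: ((f \o shift p) (h *: v) - f p)) @ 0^' -->
    (v.1 * 'D_e1 f p + v.2 * 'D_e2 f p : R).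
  by split; [apply/cvg_ex; eexists; exact: C | apply: cvg_lim C].
apply/cvgrPdist_le => /= e e0.
(* With [|h| * M < d] both steps stay in the box of size [d], and errors [e / M] weighted by [|v.1|]
   and [|v.2|] add up to at most [e]. The summand 1 keeps [M] positive when [v] is zero. *)
pose M := `|v.1| + `|v.2| + 1.
have M0 : 0 < M by rewrite /M; have := normr_ge0 v.1; have := normr_ge0 v.2; lra.
have eM : 0 < e / M by rewrite divr_gt0.
have [d d0 dP] : exists2 d : R, 0 < d & forall q, `|q.1 - p.1| < d -> `|q.2 - p.2| < d ->
    U q /\ (`|'D_e1 f p - 'D_e1 f q| <= e / M /\ `|'D_e2 f p - 'D_e2 f q| <= e / M).
  apply: (nbhs_box (P := fun q => U q /\ (`|'D_e1 f p - 'D_e1 f q| <= e / M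
    /\ `|'D_e2 f p - 'D_e2 f q| <= e / M))).
  apply: filterI; first exact: open_nbhs_nbhs.
  apply: filterI; first by have /cvgrPdist_le := c1 p Up; apply.
  by have /cvgrPdist_le := c2 p Up; apply.
have dM : 0 < d / M by rewrite divr_gt0.
near=> h.
have h0 : h != 0 by near: h; exact: nbhs_dnbhs_neq.
have hd : `|h| < d / M by near: h; exact: dnbhs0_lt.
have hM : `|h| * M < d by rewrite -ltr_pdivlMr.
have b1 : `|h * v.1| < d.
  rewrite normrM; apply: le_lt_trans hM; apply: ler_wpM2l => //.
  by rewrite /M; have := normr_ge0 v.2; lra.
have b2 : `|h * v.2| < d.
  rewrite normrM; apply: le_lt_trans hM; apply: ler_wpM2l => //.
  by rewrite /M; have := normr_ge0 v.1; lra.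
have P1 (s : R) : `|s| <= `|h * v.1| -> forall q, q = s *: e1 + p ->
   U q /\ (`|'D_e1 f p - 'D_e1 f q| <= e / M /\ `|'D_e2 f p - 'D_e2 f q| <= e / M).
  move=> sh q ->; apply: dP => /=.
    by rewrite /GRing.scale /= mulr1 addrK; apply: le_lt_trans b1.
  by rewrite /GRing.scale /= mulr0 add0r subrr normr0.
have P2 (s : R) : `|s| <= `|h * v.2| -> forall q, q = s *: e2 + ((h * v.1) *: e1 + p) ->
   U q /\ (`|'D_e1 f p - 'D_e1 f q| <= e / M /\ `|'D_e2 f p - 'D_e2 f q| <= e / M).
  move=> sh q ->; apply: dP => /=.
    by rewrite /GRing.scale /= mulr1 mulr0 add0r addrK.
  by rewrite /GRing.scale /= mulr0 mulr1 add0r addrK; apply: le_lt_trans b2.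
have [s1 s1h E1] : exists2 s : R, `|s| <= `|h * v.1| &
    f ((h * v.1) *: e1 + p) - f p = (h * v.1) * 'D_e1 f (s *: e1 + p).
  by apply: MVT_line => s /P1 /(_ _ erefl)[/df[]].
have [s2 s2h E2] : exists2 s : R, `|s| <= `|h * v.2| &
    f ((h * v.2) *: e2 + ((h * v.1) *: e1 + p)) - f ((h * v.1) *: e1 + p) =
      (h * v.2) * 'D_e2 f (s *: e2 + ((h * v.1) *: e1 + p)).
  by apply: MVT_line => s /P2 /(_ _ erefl)[/df[]].
have E3 : f (h *: v + p) = f ((h * v.2) *: e2 + ((h * v.1) *: e1 + p)).
  by congr f; apply: pair_ext; rewrite /= /GRing.scale /=; ring.
have E4 : f (h *: v + p) - f p = h * v.2 * 'D_e2 f (s2 *: e2 + ((h * v.1) *: e1 + p)) +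
    h * v.1 * 'D_e1 f (s1 *: e1 + p).
  by rewrite -E1 -E2 E3; ring.
rewrite /= E4.
have [_ [_ B2]] := P2 _ s2h _ erefl; have [_ [B1 _]] := P1 _ s1h _ erefl.
move: B1 B2; set x1 := 'D_e1 f (_ + _); set x2 := 'D_e2 f (_ + _) => B1 B2.
have -> : h^-1 *: (h * v.2 * x2 + h * v.1 * x1) = v.2 * x2 + v.1 * x1.
  by rewrite /GRing.scale /=; field.
have -> : v.1 * 'D_e1 f p + v.2 * 'D_e2 f p - (v.2 * x2 + v.1 * x1) =
  v.1 * ('D_e1 f p - x1) + v.2 * ('D_e2 f p - x2) by ring.
apply: (le_trans (ler_normD _ _)); rewrite !normrM.
have -> : e = (M - (`|v.1| + `|v.2|)) * (e / M) + (`|v.1| * (e / M) + `|v.2| * (e / M)).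
  by field; rewrite gt_eqF.
rewrite -[leLHS]add0r; apply: lerD; last by apply: lerD; apply: ler_wpM2l.
by rewrite mulr_ge0 ?ltW// /M; lra.
Unshelve. all: by end_near. Qed.

Lemma smooth_D U f v : open U -> smooth_on U f -> smooth_on U ('D_v f).
Proof.
move=> oU sf k; have [_ [_ [f1 f2]]] := sf k.+1.
apply: (Ck_ext oU _ (Ck_lin v.1 v.2 oU f1 f2)) => p Up.
by have [_ ->] := is_derive_dir v oU (sf 1%N) Up.
Qed.

Lemma smooth_derivable U f v p : open U -> smooth_on U f -> U p -> derivable f p v.
Proof. by move=> oU sf Up; have [] := is_derive_dir v oU (sf 1%N) Up. Qed.

Lemma smooth_deriveE U f v p : open U -> smooth_on U f -> U p ->
  'D_v f p = v.1 * 'D_e1 f p + v.2 * 'D_e2 f p.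
Proof. by move=> oU sf Up; have [_ ->] := is_derive_dir v oU (sf 1%N) Up. Qed.

Lemma smooth_continuous U f p : smooth_on U f -> U p -> {for p, continuous f}.
Proof. by move=> sf; apply: (sf 0%N). Qed.

Lemma smooth_is_derive U f v p : open U -> smooth_on U f -> U p -> is_derive p v f ('D_v f p).
Proof. by move=> oU sf Up; exact: derivableP (smooth_derivable oU sf Up). Qed.

(** The mean value theorem is applied to the increment of [f] along [k *: v], in direction [u], and
    then to ['D_u f] in direction [v]. *)
Lemma second_difference U f u v p (h k : R) : open U -> smooth_on U f ->
  (forall s t : R, `|s| <= `|h| -> `|t| <= `|k| -> U (t *: v + (s *: u + p))) ->
  exists s t : R, [/\ `|s| <= `|h|, `|t| <= `|k| &
    f (k *: v + (h *: u + p)) - f (h *: u + p) - f (k *: v + p) + f p =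
      h * k * 'D_v ('D_u f) (t *: v + (s *: u + p))].
Proof.
move=> oU sf Ubox.
pose F q := f (k *: v + q) - f q.
have U0 (s : R) : `|s| <= `|h| -> U (s *: u + p).
  by move=> sh; have := Ubox s 0 sh; rewrite normr0 normr_ge0 scale0r add0r; apply.
have dF (s : R) : `|s| <= `|h| ->
   is_derive (s *: u + p) u F ('D_u f (k *: v + (s *: u + p)) - 'D_u f (s *: u + p)).
  move=> sh.
  apply: (is_deriveB (f := fun q => f (k *: v + q))).
    apply: (is_derive_affine (s := fun q => k *: v + q) (u' := u)).
      by move=> r; rewrite addrCA.
    by apply: (smooth_is_derive _ oU sf); apply: Ubox.
  by apply: (smooth_is_derive _ oU sf); apply: U0.
have [s sh E1] : exists2 s : R, `|s| <= `|h| & F (h *: u + p) - F p = h * 'D_u F (s *: u + p).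
  by apply: MVT_line => s /dF[].
have [t tk E2] : exists2 t : R, `|t| <= `|k| &
    'D_u f (k *: v + (s *: u + p)) - 'D_u f (s *: u + p) = k * 'D_v ('D_u f) (t *: v + (s *: u + p)).
  apply: (@MVT_line ('D_u f) (s *: u + p) v k) => t tk.
  exact: (smooth_derivable oU (smooth_D u oU sf) (Ubox _ _ sh tk)).
exists s, t; split => //.
have [_ E3] := dF s sh.
move: E1; rewrite E3 E2 mulrA => <-; rewrite /F; ring.
Qed.

(** Schwarz's theorem: with equal steps the second difference is symmetric in [u] and [v], so one
    mixed derivative equals the other at points arbitrarily close to [p]. *)
Lemma smooth_commD U f u v p : open U -> smooth_on U f -> U p ->
  'D_v ('D_u f) p = 'D_u ('D_v f) p.
Proof.
move=> oU sf Up.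
apply/eqP; rewrite -subr_eq0 -normr_le0; apply/ler_addgt0Pl => e e0; rewrite addr0.
have e2 : 0 < e / 2 by rewrite divr_gt0.
pose P q := U q /\ (`|'D_v ('D_u f) p - 'D_v ('D_u f) q| <= e / 2 /\
                     `|'D_u ('D_v f) p - 'D_u ('D_v f) q| <= e / 2).
have nP : nbhs p P.
  have C v' u' := smooth_continuous (smooth_D v' oU (smooth_D u' oU sf)) Up.
  apply: filterI; first exact: open_nbhs_nbhs.
  apply: filterI; first by have /cvgrPdist_le := C v u; apply.
  by have /cvgrPdist_le := C u v; apply.
have [d d0 dP] := nbhs_box nP.
pose M := `|u.1| + `|u.2| + `|v.1| + `|v.2| + 1.
have [M1 M2] := (normr_ge0 u.1, normr_ge0 u.2).
have [M3 M4] := (normr_ge0 v.1, normr_ge0 v.2).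
have M0 : 0 < M by rewrite /M; lra.
pose h := d / M / 2.
have h0 : 0 < h by rewrite /h !divr_gt0.
have hM : h * M < d by rewrite /h -mulrA [2^-1 * M]mulrC mulrA divfK ?gt_eqF//; lra.
have box (s t : R) : `|s| <= `|h| -> `|t| <= `|h| -> P (t *: v + (s *: u + p)).
  rewrite (ger0_norm (ltW h0)) => sh th; apply: dP.
    rewrite /= /GRing.scale /= addrA addrK; apply: (le_lt_trans (ler_normD _ _)).
    rewrite !normrM; apply: le_lt_trans hM.
    have : `|t| * `|v.1| <= h * `|v.1| by apply: ler_wpM2r.
    have : `|s| * `|u.1| <= h * `|u.1| by apply: ler_wpM2r.
    have := mulr_ge0 (ltW h0) M2; have := mulr_ge0 (ltW h0) M4.
    by rewrite /M; lra.
  rewrite /= /GRing.scale /= addrA addrK; apply: (le_lt_trans (ler_normD _ _)).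
  rewrite !normrM; apply: le_lt_trans hM.
  have : `|t| * `|v.2| <= h * `|v.2| by apply: ler_wpM2r.
  have : `|s| * `|u.2| <= h * `|u.2| by apply: ler_wpM2r.
  have := mulr_ge0 (ltW h0) M1; have := mulr_ge0 (ltW h0) M3.
  by rewrite /M; lra.
have swap (s t : R) : t *: v + (s *: u + p) = s *: u + (t *: v + p) by rewrite addrCA.
have [s [t [sh th E1]]] := @second_difference U f u v p h h oU sf
  (fun s t sh th => (box s t sh th).1).
have box' (a b : R) : `|a| <= `|h| -> `|b| <= `|h| -> U (b *: u + (a *: v + p)).
  by move=> ah bh; rewrite -swap; have [] := box b a bh ah.
have [s' [t' [sh' th' E2]]] := @second_difference U f v u p h h oU sf box'.
have [_ [B1 _]] := box _ _ sh th; have [_ [_ B2]] := box _ _ th' sh'.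
move: B2; rewrite swap => B2.
have E : 'D_v ('D_u f) (t *: v + (s *: u + p)) = 'D_u ('D_v f) (t' *: u + (s' *: v + p)).
  apply: (@mulfI _ (h * h)); first by rewrite mulf_neq0 ?gt_eqF.
  by refine (etrans (esym E1) (etrans _ E2)); rewrite swap; congr (_ + _); rewrite addrAC.
rewrite E in B1.
have tri (a b x : R) : `|a - x| <= e / 2 -> `|b - x| <= e / 2 -> `|a - b| <= e.
  move=> ax bx; rewrite (_ : a - b = (a - x) - (b - x)); last by ring.
  by apply: (le_trans (ler_normB _ _)); rewrite (splitr e); apply: lerD.
exact: tri B1 B2.
Qed.

End Calculus.

(** * Linear differential equations and the Codazzi equations along a line *)

Section LinearODE.
Context {R : realType}.
Implicit Types (a b s : R) (y dy c e : R -> R).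

Lemma is_derive_continuous y s d : is_derive s (1 : R) y d -> {for s, continuous y}.
Proof. by move=> [ds _]; exact: differentiable_continuous ((derivable1_diffP _ _).1 ds). Qed.

Lemma within_continuous y a b : (forall s, a <= s <= b -> {for s, continuous y}) ->
  {within `[a, b], continuous y}.
Proof. by move=> yc; apply: continuous_in_subspaceT => s; rewrite inE /= in_itv /= => /yc. Qed.

(** Gronwall: [y ^ 2] times [exp (- 2 K s)] does not increase and [y ^ 2] times [exp (2 K s)] does
    not decrease, so a zero propagates in both directions. *)
Lemma ode_bound y dy a b (K : R) : a <= b ->
  (forall s, a <= s <= b -> {for s, continuous y}) ->
  (forall s, a < s < b -> is_derive s (1 : R) y (dy s)) ->
  (forall s, a < s < b -> `|dy s| <= K * `|y s|) ->
  (y a = 0 <-> y b = 0).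
Proof.
rewrite le_eqVlt => /predU1P[->//|ab] yc yd yK.
have ed (k s : R) : is_derive s (1 : R) (fun s : R => expR (k * s)) (expR (k * s) * k).
  apply: (is_derive1_comp (f := expR) (g := fun s => k * s)).
  by have := is_deriveZ k (is_derive_id s (1 : R)); rewrite /GRing.scale /= mulr1.
have M (k : R) : exists2 s, a < s < b & (y b) ^+ 2 * expR (k * b) - (y a) ^+ 2 * expR (k * a)
    = ((2 * y s * dy s + k * (y s) ^+ 2) * expR (k * s)) * (b - a).
  have [||s sI E] := @MVT R (fun s => y s * y s * expR (k * s))
     (fun s => (2 * y s * dy s + k * (y s) ^+ 2) * expR (k * s)) a b ab.
  - move=> s; rewrite in_itv /= => sab.
    have := is_derive_mul (is_derive_mul (yd s sab) (yd s sab)) (ed k s).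
    by move=> /is_derive_eq; apply; ring.
  - apply: within_continuous => s sab.
    apply: cvgM; last exact: is_derive_continuous (ed k s).
    by apply: cvgM; apply: yc.
  - by exists s; [move: sI; rewrite in_itv | rewrite !expr2 E -expr2].
have sq0 (x k : R) : x ^+ 2 * expR k <= 0 -> x = 0.
  rewrite pmulr_lle0 ?expR_gt0// => H.
  by apply/eqP; rewrite -sqrf_eq0 eq_le H sqr_ge0.
have dyK s : a < s < b -> `|2 * y s * dy s| <= 2 * K * (y s) ^+ 2.
  move=> sab; rewrite !normrM ger0_norm// -[y s ^+ 2]ger0_norm ?sqr_ge0// normrX.
  have := ler_wpM2l (normr_ge0 (y s)) (yK s sab).
  by rewrite expr2; lra.
have ba : 0 < b - a by rewrite subr_gt0.
split=> y0.
- have [s sI E] := M (- (2 * K)); apply: (sq0 _ (- (2 * K) * b)).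
  move: E; rewrite y0 expr0n mul0r subr0 => ->.
  rewrite pmulr_lle0// pmulr_lle0 ?expR_gt0//.
  by have := dyK s sI; rewrite ler_norml => /andP[_]; lra.
- have [s sI E] := M (2 * K); apply: (sq0 _ ((2 * K) * a)).
  rewrite -oppr_ge0; move: E; rewrite y0 expr0n mul0r sub0r => ->.
  rewrite pmulr_lge0// pmulr_lge0 ?expR_gt0//.
  by have := dyK s sI; rewrite ler_norml => /andP[+ _]; lra.
Qed.

(** The maximum of [|e / c|] on the compact interval serves as the constant of [ode_bound]. The
    undivided form is the one in which the Codazzi equations appear below. *)
Lemma ode_linear y dy c e a b : a <= b ->
  (forall s, a <= s <= b -> is_derive s (1 : R) y (dy s)) ->
  (forall s, a <= s <= b -> {for s, continuous c}) ->
  (forall s, a <= s <= b -> {for s, continuous e}) ->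
  (forall s, a <= s <= b -> c s != 0) ->
  (forall s, a <= s <= b -> c s * dy s = e s * y s) ->
  y a = 0 -> y b = 0.
Proof.
move=> ab yd cc ce c0 E.
have [s0 _ Hmax] : exists2 s, s \in `[a, b] & forall t, t \in `[a, b] -> `|e t / c t| <= `|e s / c s|.
  apply: (@EVT_max R (fun s => `|e s / c s|)) => //.
  apply: within_continuous => s sab.
  have C : {for s, continuous (fun s => e s / c s)}.
    by apply: cvgM; [exact: ce | apply: cvgV; [exact: c0 | exact: cc]].
  exact: (cvg_norm C).
suff [] : y a = 0 <-> y b = 0 by [].
apply: (@ode_bound y dy a b `|e s0 / c s0| ab) => [s sab|s /andP[sa sb]|s /andP[sa sb]].
- exact: is_derive_continuous (yd s sab).
- by apply: yd; rewrite !ltW.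
- have sab : a <= s <= b by rewrite !ltW.
  have -> : dy s = e s / c s * y s by rewrite mulrAC -E// mulrAC divff ?c0// mul1r.
  by rewrite normrM ler_wpM2r// Hmax// in_itv.
Qed.

Lemma derive_zero_const y a b : a <= b ->
  (forall s, a <= s <= b -> {for s, continuous y}) ->
  (forall s, a < s < b -> is_derive s (1 : R) y 0) -> y a = y b.
Proof.
move=> ab yc yd; apply/eqP; rewrite eq_sym -subr_eq0; apply/eqP.
have yd' s : s \in `]a, b[%R -> is_derive s (1 : R) y ((fun=> 0) s).
  by rewrite in_itv; apply: yd.
have [s _ ->] := MVT_segment ab yd' (within_continuous yc).
by rewrite mul0r.
Qed.

End LinearODE.

Section Ruling.
Context {R : realType}.
Implicit Types (f g w : R * R -> R) (p q u v : R * R) (U : set (R * R)).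

Lemma derive_line_smooth U f p v (s : R) : open U -> smooth_on U f -> U (s *: v + p) ->
  is_derive s (1 : R) (fun s : R => f (s *: v + p)) ('D_v f (s *: v + p)).
Proof. by move=> oU sf Us; exact: (derive_line (smooth_derivable oU sf Us)). Qed.

Lemma derive_congr U f g v p : open U -> (forall p, U p -> f p = g p) -> U p ->
  'D_v f p = 'D_v g p.
Proof.
move=> oU fg Up.
have N := near_eq_open oU fg Up.
exact: near_eq_derive N.
Qed.

Lemma smooth_commD_vvu U w u v p : open U -> smooth_on U w -> U p ->
  'D_u ('D_v ('D_v w)) p = 'D_v ('D_v ('D_u w)) p.
Proof.
move=> oU sw Up; refine (etrans (smooth_commD v u oU (smooth_D v oU sw) Up) _).
exact: (derive_congr v oU (fun q => smooth_commD v u oU sw) Up).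
Qed.

End Ruling.

(* [A], [B], [C] are the Hessian entries of a function in the frame [v], [u];
   only their Codazzi relations and the vanishing of the determinant matter. *)
Section CodazziLine.
Context {R : realType} (U : set (R * R)) (A B C : R * R -> R) (u v : R * R).
Hypotheses (oU : open U) (sA : smooth_on U A) (sB : smooth_on U B) (sC : smooth_on U C).
Hypothesis DuA : forall p, U p -> 'D_u A p = 'D_v B p.
Hypothesis DuB : forall p, U p -> 'D_u B p = 'D_v C p.
Hypothesis AC : forall p, U p -> A p * C p = B p * B p.
Implicit Types (p q : R * R).

Let DuuA p : U p -> 'D_u ('D_u A) p = 'D_v ('D_v C) p.
Proof.
move=> Up; rewrite (derive_congr u oU DuA Up) (smooth_commD v u oU sB Up).
exact: (derive_congr v oU DuB Up).
Qed.

Let DuAC p : U p -> A p * 'D_u C p + C p * 'D_u A p = B p * 'D_u B p + B p * 'D_u B p.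
Proof.
move=> Up.
have [_ <-] := is_derive_mul (smooth_is_derive u oU sA Up) (smooth_is_derive u oU sC Up).
have [_ <-] := is_derive_mul (smooth_is_derive u oU sB Up) (smooth_is_derive u oU sB Up).
exact: (derive_congr u oU AC Up).
Qed.

(** The derivative of [A C = B ^ 2] in direction [u], multiplied by [C], becomes a linear equation
    for [B] along [v] once [A C] is replaced by [B ^ 2]. *)
Let B_ode p : U p -> C p ^+ 2 * 'D_v B p = (2 * C p * 'D_u B p - B p * 'D_u C p) * B p.
Proof.
move=> Up; have := DuAC Up; have := AC Up; rewrite DuA//.
move: (A p) (B p) (C p) ('D_u C p) ('D_u B p) ('D_v B p) => a b c x y z E1 E2.
have -> : c ^+ 2 * z = c * (a * x + c * z) - a * c * x by ring.
by rewrite E1 E2; ring.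
Qed.

(** The relation [A C = B ^ 2] is differentiated twice in direction [u]. Where [B] vanishes and [C]
    does not, [A] and ['D_u A] vanish too, and only the terms [C 'D_u 'D_u A] and [2 ('D_u B) ^ 2]
    survive. The resulting equation says that [1 / C] is affine along [v]. *)
Let C_ode p : U p -> C p != 0 -> B p = 0 ->
  C p * 'D_v ('D_v C) p = 2 * 'D_v C p ^+ 2.
Proof.
move=> Up c0 b0.
have d := fun f sf => @smooth_is_derive R U f u p oU sf Up.
have sDA := smooth_D u oU sA; have sDB := smooth_D u oU sB; have sDC := smooth_D u oU sC.
have [_ E1] := is_derive_lin 1 1 (is_derive_mul (d _ sA) (d _ sDC)) (is_derive_mul (d _ sC) (d _ sDA)).
have [_ E2] := is_derive_lin 1 1 (is_derive_mul (d _ sB) (d _ sDB)) (is_derive_mul (d _ sB) (d _ sDB)).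
have E3 q : U q -> 1 * (A q * 'D_u C q) + 1 * (C q * 'D_u A q)
     = 1 * (B q * 'D_u B q) + 1 * (B q * 'D_u B q).
  by move=> Uq; rewrite !mul1r; exact: DuAC.
have := derive_congr u oU E3 Up; rewrite {}E1 {}E2 b0 (DuuA Up) (DuB Up).
have := B_ode Up; have := AC Up; rewrite b0 (DuA Up).
move: (A p) (C p) c0 ('D_v B p) ('D_v C p) ('D_v ('D_v C) p) ('D_u C p) ('D_u ('D_u C) p) ('D_u ('D_u B) p).
move=> a c c0 x y z t r m; rewrite !mul0r !mulr0 => /eqP; rewrite mulf_eq0 (negPf c0) orbF => /eqP ->.
move=> /eqP; rewrite mulf_eq0 expf_eq0 /= (negPf c0) /= => /eqP ->.
by rewrite expr2; lra.
Qed.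

(** As long as [C] has no zero, [B_ode] keeps [B] at zero, and then [C_ode] makes [1 / C] affine. An
    affine function stays bounded on a segment, so [C] cannot reach zero. *)
Lemma codazzi_line p (S : R) : 0 <= S ->
  (forall s, 0 <= s <= S -> U (s *: v + p)) -> B p = 0 -> C p != 0 ->
  B (S *: v + p) = 0 /\ C (S *: v + p) != 0.
Proof.
move=> S0 US Bp Cp.
have at0 (f : R * R -> R) : f (0 *: v + p) = f p :> R by rewrite scale0r add0r.
have d (f : R * R -> R) (s : R) : smooth_on U f -> 0 <= s <= S ->
    is_derive s (1 : R) (fun s : R => f (s *: v + p)) ('D_v f (s *: v + p)).
  by move=> sf sI; exact: (@derive_line_smooth R U f p v s oU sf (US s sI)).
have c (f : R * R -> R) (s : R) : smooth_on U f -> 0 <= s <= S -> {for s, continuous (fun s : R => f (s *: v + p))}.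
  by move=> sf sS; exact: is_derive_continuous (d f s sf sS).
have sDvC := smooth_D v oU sC.
have B0 s : 0 <= s <= S -> (forall t, 0 <= t <= s -> C (t *: v + p) != 0) -> B (s *: v + p) = 0.
  move=> /andP[s0 sS] Ct.
  have tS t : 0 <= t <= s -> 0 <= t <= S by move=> /andP[-> ts]; exact: le_trans sS.
  apply: (@ode_linear R (fun s => B (s *: v + p)) (fun s => 'D_v B (s *: v + p))
    (fun s => C (s *: v + p) * C (s *: v + p))
    (fun s => 2 * C (s *: v + p) * 'D_u B (s *: v + p) - B (s *: v + p) * 'D_u C (s *: v + p)) 0 s s0).
  - by move=> t /tS; exact: d.
  - by move=> t /tS tI; apply: cvgM; exact: (c _ _ sC tI).
  - move=> t /tS tI; apply: cvgB; apply: cvgM.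
    + by apply: cvgMr; exact: (c _ _ sC tI).
    + exact: (c _ _ (smooth_D u oU sB) tI).
    + exact: (c _ _ sB tI).
    + exact: (c _ _ (smooth_D u oU sC) tI).
  - by move=> t tI; rewrite mulf_neq0// Ct.
  - by move=> t /tS /US Ut; rewrite -expr2; exact: B_ode.
  - by rewrite at0.
suff C0 s : 0 <= s <= S -> C (s *: v + p) != 0.
  have SS : 0 <= S <= S by rewrite S0 lexx.
  split; last exact: C0.
  by apply: B0 => // t; exact: C0.
apply: contraPneq => Cs0 sS.
(* The infimum [r] of these zeros is again a zero by continuity, and [C] has no zero before it. *)
pose Z : set R := [set t | 0 <= t <= S /\ C (t *: v + p) = 0].
have Zs : Z s by [].
have Z0 : lbound Z 0 by move=> t [/andP[]].
have hZ : has_inf Z by split; [exists s | exists 0].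
have r0 : 0 <= inf Z by apply: lb_le_inf => //; exists s.
have rs : inf Z <= s by apply: ge_inf => //; exists 0.
move: (inf Z) (@inf_adherent _ Z) (@ge_inf _ Z) r0 rs => r rad rle r0 rs.
have rS : 0 <= r <= S by rewrite r0; case/andP: sS => _; exact: le_trans.
have Clt t : 0 <= t < r -> C (t *: v + p) != 0.
  move=> /andP[t0 tr]; apply/eqP => Ct.
  suff : r <= t by rewrite leNgt tr.
  apply: rle; first by exists 0.
  by split => //; rewrite t0 /=; case/andP: rS => _; lra.
have Cr : C (r *: v + p) = 0.
  apply/eqP; apply: contrapT => /negP Cr.
  have /cvgr_neq0 /(_ Cr) /nbhs_normP[e /= e0 He] := c C r sC rS.
  have [t Zt tre] := rad e e0 hZ.
  have rt : r <= t by apply: rle => //; exists 0.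
  have /negP[] : C (t *: v + p) != 0.
    by apply: He; rewrite /ball_ /= ltr_distl; apply/andP; split; lra.
  by apply/eqP; case: Zt.
(* [C' / C ^ 2] is minus the derivative of [1 / C], hence constant before [r]: the difference
   [C' - K C ^ 2] vanishes at the start and solves [C y' = 2 C' y]. *)
pose K := 'D_v C p / C p ^+ 2.
have EK t : 0 <= t < r -> 'D_v C (t *: v + p) = K * C (t *: v + p) ^+ 2.
  move=> /andP[t0 tr].
  have tS x : 0 <= x <= t -> 0 <= x <= S by move=> /andP[-> xt]; case/andP: rS => _; lra.
  have xr x : 0 <= x <= t -> 0 <= x < r by move=> /andP[-> xt]; lra.
  suff : 1 * 'D_v C (t *: v + p) + (- K) * (C (t *: v + p) * C (t *: v + p)) = 0.
    by rewrite mul1r mulNr -expr2 => /eqP; rewrite subr_eq0 => /eqP.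
  apply: (@ode_linear R (fun s => 1 * 'D_v C (s *: v + p) + (- K) * (C (s *: v + p) * C (s *: v + p)))
    (fun s => 1 * 'D_v ('D_v C) (s *: v + p) + (- K) *
      (C (s *: v + p) * 'D_v C (s *: v + p) + C (s *: v + p) * 'D_v C (s *: v + p)))
    (fun s => C (s *: v + p)) (fun s => 2 * 'D_v C (s *: v + p)) 0 t t0).
  - move=> x /tS xI.
    exact: (is_derive_lin 1 (- K) (d _ _ sDvC xI) (is_derive_mul (d _ _ sC xI) (d _ _ sC xI))).
  - by move=> x /tS xI; exact: c.
  - by move=> x /tS xI; apply: cvgMr; exact: (c _ _ sDvC xI).
  - by move=> x /xr; exact: Clt.
  - move=> x xI; have xC := Clt _ (xr _ xI).
    have Bx : B (x *: v + p) = 0.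
      apply: B0; first exact: tS.
      by move=> y /andP[y0 yx]; apply: Clt; rewrite y0 /=; case/andP: (xr _ xI) => _; lra.
    have := C_ode (US _ (tS _ xI)) xC Bx.
    move: (C _) ('D_v C _) ('D_v ('D_v C) _) => a b e E.
    by rewrite mul1r mulrDr E; ring.
  - have C2 : C p ^+ 2 != 0 by rewrite expf_eq0.
    by rewrite (at0 C) (at0 ('D_v C)) mul1r mulNr /K -expr2 (divfK C2) subrr.
(* Before [r] one has [C' = (K C) C], so a bound for [|K C|] is a Gronwall constant, and a zero at
   [r] would force a zero at [p]. *)
have [m _ Hm] : exists2 m, m \in `[0, r] & forall t, t \in `[0, r] -> `|K * C (t *: v + p)| <= `|K * C (m *: v + p)|.
  apply: (@EVT_max R (fun t => `|K * C (t *: v + p)|)) => //.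
  apply: within_continuous => t /andP[t0 tr].
  apply: (@cvg_norm _ R^o); apply: cvgMr; apply: c => //; rewrite t0 /=.
  by case/andP: rS => _; exact: le_trans.
suff [_ /(_ Cr)] : C (0 *: v + p) = 0 <-> C (r *: v + p) = 0 by rewrite at0; move/eqP; rewrite (negPf Cp).
have tS t : 0 <= t <= r -> 0 <= t <= S by move=> /andP[-> tr]; case/andP: rS => _; lra.
apply: (@ode_bound R (fun s => C (s *: v + p)) (fun s => 'D_v C (s *: v + p)) 0 r
  `|K * C (m *: v + p)| r0).
- by move=> t /tS; exact: c.
- by move=> t /andP[t0 tr]; apply: d => //; apply: tS; rewrite !ltW.
- move=> t /andP[t0 tr]; rewrite EK ?(ltW t0)// expr2 mulrA normrM ler_wpM2r//.
  by apply: Hm; rewrite in_itv /= !ltW.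
Qed.

End CodazziLine.

(** * Flat surfaces *)

Section Dot.
Context {R : realType}.
Implicit Types (a b c e : 'I_3 -> R).

Definition dot a b : R := \sum_(i < 3) a i * b i.

Lemma dotE a b : dot a b = a 0 * b 0 + a 1 * b 1 + a 2 * b 2.
Proof.
rewrite /dot !big_ord_recl big_ord0 addr0 addrA; congr (_ * _ + _ * _ + _ * _);
  by [congr a; apply: val_inj | congr b; apply: val_inj].
Qed.

Lemma forall_I3 (P : 'I_3 -> Prop) : P 0 -> P 1 -> P 2 -> forall i, P i.
Proof.
move=> P0 P1 P2 [[|[|[|//]]] Hi].
- by rewrite (_ : Ordinal Hi = 0) //; apply: val_inj.
- by rewrite (_ : Ordinal Hi = 1) //; apply: val_inj.
- by rewrite (_ : Ordinal Hi = 2) //; apply: val_inj.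
Qed.

Lemma dotC a b : dot a b = dot b a.
Proof. by rewrite !dotE; ring. Qed.

Lemma dot_congrl a b c : (forall i, a i = c i) -> dot a b = dot c b.
Proof. by move=> ac; apply: eq_bigr => i _; rewrite ac. Qed.

Lemma dot_congrr a b c : (forall i, a i = c i) -> dot b a = dot b c.
Proof. by move=> ac; apply: eq_bigr => i _; rewrite ac. Qed.

(** Addition in ['I_3] is modulo 3, which gives the cyclic formula of the vector product. *)
Definition cross a b : 'I_3 -> R := fun i =>
  a (i + 1) * b (i + 2) - a (i + 2) * b (i + 1).

Lemma crossE a b : (cross a b 0 = a 1 * b 2 - a 2 * b 1) *
  (cross a b 1 = a 2 * b 0 - a 0 * b 2) * (cross a b 2 = a 0 * b 1 - a 1 * b 0).
Proof.
by rewrite /cross; split; [split|]; congr (a _ * b _ - a _ * b _); apply: val_inj.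
Qed.

Lemma cross_unit e f : dot e e = 1 -> dot f f = 1 -> dot e f = 0 ->
  dot (cross e f) (cross e f) = 1.
Proof.
move=> ee ff ef; have [[N0 N1] N2] := crossE e f.
rewrite -[RHS](_ : dot e e * dot f f - dot e f ^+ 2 = 1).
  by rewrite [LHS]dotE N0 N1 N2 !dotE; ring.
by rewrite ee ff ef; ring.
Qed.

(** By the double vector product formula [x] has zero vector product with the unit vector [n], hence
    is its multiple; the three coordinates of that product are [c01], [c12], [c20]. *)
Lemma normal_span e f x : dot e e = 1 -> dot f f = 1 -> dot e f = 0 ->
  dot x e = 0 -> dot x f = 0 -> forall i, x i = dot x (cross e f) * cross e f i.
Proof.
move=> ee ff ef xe xf; set n := cross e f.
have [[N0 N1] N2] := crossE e f; rewrite -/n in N0 N1 N2.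
have nn : n 0 * n 0 + n 1 * n 1 + n 2 * n 2 = 1 by rewrite -dotE cross_unit.
have c01 : x 0 * n 1 - x 1 * n 0 = 0.
  rewrite -[RHS](_ : dot x f * e 2 - dot x e * f 2 = 0); last by rewrite xe xf; ring.
  by rewrite N0 N1 !dotE; ring.
have c12 : x 1 * n 2 - x 2 * n 1 = 0.
  rewrite -[RHS](_ : dot x f * e 0 - dot x e * f 0 = 0); last by rewrite xe xf; ring.
  by rewrite N2 N1 !dotE; ring.
have c20 : x 2 * n 0 - x 0 * n 2 = 0.
  rewrite -[RHS](_ : dot x f * e 1 - dot x e * f 1 = 0); last by rewrite xe xf; ring.
  by rewrite N0 N2 !dotE; ring.
apply: forall_I3; rewrite -[LHS]mulr1 -nn !dotE.
- rewrite -[LHS]subr0 -(mulr0 (n 1)) -c01 -[X in X = _]addr0 -(mulr0 (n 2)) -c20; ring.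
- rewrite -[LHS]addr0 -(mulr0 (n 0)) -c01 -[X in X = _]subr0 -(mulr0 (n 2)) -c12; ring.
- rewrite -[LHS]addr0 -(mulr0 (n 1)) -c12 -[X in X = _]subr0 -(mulr0 (n 0)) -c20; ring.
Qed.

End Dot.

(** * The second fundamental form of an isometric immersion and its rulings *)

Section FlatSurface.
Context {R : realType} (U : set (R * R)) (g : 'I_3 -> R * R -> R).
Hypotheses (oU : open U) (sg : forall i, smooth_on U (g i)).
Variables e1 e2 : R * R.
Hypothesis dirE : forall (w : R * R -> R) v p, smooth_on U w -> U p ->
  'D_v w p = v.1 * 'D_e1 w p + v.2 * 'D_e2 w p.
Local Notation D v f := (fun i => 'D_v (f i)).
Local Notation "f ^@ p" := (fun i => f i p) (at level 10).
Hypothesis D11 : forall p, U p -> dot ((D e1 g) ^@ p) ((D e1 g) ^@ p) = 1.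
Hypothesis D22 : forall p, U p -> dot ((D e2 g) ^@ p) ((D e2 g) ^@ p) = 1.
Hypothesis D12 : forall p, U p -> dot ((D e1 g) ^@ p) ((D e2 g) ^@ p) = 0.
Implicit Types (p q u v : R * R).

Let sD v (f : 'I_3 -> R * R -> R) : (forall i : 'I_3, smooth_on U (f i)) -> forall i, smooth_on U (D v f i).
Proof. by move=> sf i; exact: smooth_D oU (sf i). Qed.

Lemma dot_derive (f h : 'I_3 -> R * R -> R) (k : R) v p :
  (forall i, smooth_on U (f i)) -> (forall i, smooth_on U (h i)) ->
  (forall p, U p -> dot (f ^@ p) (h ^@ p) = k) -> U p ->
  dot ((D v f) ^@ p) (h ^@ p) + dot (f ^@ p) ((D v h) ^@ p) = 0.
Proof.
move=> sf sh fh Up.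
have d i := is_derive_mul (smooth_is_derive v oU (sf i) Up) (smooth_is_derive v oU (sh i) Up).
have [_ E] := is_derive_lin 1 1 (is_derive_lin 1 1 (d 0) (d 1)) (d 2).
have E0 q : U q -> 1 * (1 * (f 0 q * h 0 q) + 1 * (f 1 q * h 1 q)) + 1 * (f 2 q * h 2 q) = cst k q.
  by move=> /fh <-; rewrite dotE /=; ring.
have := derive_congr v oU E0 Up; rewrite {}E derive_cst !dotE /=.
move: (f 0 p) (f 1 p) (f 2 p) (h 0 p) (h 1 p) (h 2 p) ('D_v (f 0) p) ('D_v (f 1) p) ('D_v (f 2) p)
  ('D_v (h 0) p) ('D_v (h 1) p) ('D_v (h 2) p) => *.
by lra.
Qed.

Lemma hessian_bilinear (w : R * R -> R) u v p : smooth_on U w -> U p ->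
  'D_u ('D_v w) p = u.1 * v.1 * 'D_e1 ('D_e1 w) p + (u.1 * v.2 + u.2 * v.1) * 'D_e1 ('D_e2 w) p
    + u.2 * v.2 * 'D_e2 ('D_e2 w) p.
Proof.
move=> sw Up.
have E e : 'D_e ('D_v w) p = v.1 * 'D_e ('D_e1 w) p + v.2 * 'D_e ('D_e2 w) p.
  have [_ <-] := is_derive_lin v.1 v.2 (smooth_is_derive e oU (smooth_D e1 oU sw) Up)
    (smooth_is_derive e oU (smooth_D e2 oU sw) Up).
  exact: (derive_congr e oU (fun q => @dirE w v q sw) Up).
have alg (L F1 F2 a b c b' u1 u2 v1 v2 : R) : L = u1 * F1 + u2 * F2 -> F1 = v1 * a + v2 * b ->
    F2 = v1 * b' + v2 * c -> b' = b -> L = u1 * v1 * a + (u1 * v2 + u2 * v1) * b + u2 * v2 * c.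
  by move=> -> -> -> ->; ring.
exact: (alg _ _ _ _ _ _ _ _ _ _ _ (dirE u (smooth_D v oU sw) Up) (E e1) (E e2)
  (smooth_commD e1 e2 oU sw Up)).
Qed.

(** Differentiating the metric relations shows that every second derivative is orthogonal to the
    tangent plane, hence a multiple of the normal [n]. The relation [x * z = y * y] is the Gauss
    equation for curvature zero. *)
Lemma second_fundamental_form p : U p -> exists (n : 'I_3 -> R) (x y z : R),
  x * z = y * y /\ forall i u v, 'D_u ('D_v (g i)) p =
     n i * (u.1 * v.1 * x + (u.1 * v.2 + u.2 * v.1) * y + u.2 * v.2 * z).
Proof.
move=> Up.
have s1 := sD e1 sg; have s2 := sD e2 sg.
have C i q : U q -> 'D_e2 ('D_e1 (g i)) q = 'D_e1 ('D_e2 (g i)) q.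
  by move=> Uq; exact: (smooth_commD e1 e2 oU (sg i) Uq).
have Yd q b : U q -> dot ((D e2 (D e1 g)) ^@ q) b = dot ((D e1 (D e2 g)) ^@ q) b.
  by move=> Uq; exact: (dot_congrl b (fun i => C i q Uq)).
have half (a b : R) : a + b = 0 -> b = a -> a = 0 by move=> /[swap] ->; lra.
have X1 q : U q -> dot ((D e1 (D e1 g)) ^@ q) ((D e1 g) ^@ q) = 0.
  by move=> Uq; exact: half (dot_derive e1 s1 s1 D11 Uq) (dotC _ _).
have Y1 q : U q -> dot ((D e1 (D e2 g)) ^@ q) ((D e1 g) ^@ q) = 0.
  move=> Uq; have H := half _ _ (dot_derive e2 s1 s1 D11 Uq) (dotC _ _).
  have H' := Yd q ((D e1 g) ^@ q) Uq.
  rewrite -H'.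
  exact: H.
have Y2 q : U q -> dot ((D e1 (D e2 g)) ^@ q) ((D e2 g) ^@ q) = 0.
  by move=> Uq; exact: half (dot_derive e1 s2 s2 D22 Uq) (dotC _ _).
have Z2 q : U q -> dot ((D e2 (D e2 g)) ^@ q) ((D e2 g) ^@ q) = 0.
  by move=> Uq; exact: half (dot_derive e2 s2 s2 D22 Uq) (dotC _ _).
have other (a b c : R) : a + b = 0 -> b = c -> c = 0 -> a = 0 by move=> E bc c0; move: E; rewrite bc c0 addr0.
have X2 q : U q -> dot ((D e1 (D e1 g)) ^@ q) ((D e2 g) ^@ q) = 0.
  by move=> Uq; exact: other (dot_derive e1 s1 s2 D12 Uq) (dotC _ _) (Y1 q Uq).
have Z1 q : U q -> dot ((D e2 (D e2 g)) ^@ q) ((D e1 g) ^@ q) = 0.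
  move=> Uq; have E : dot ((D e1 g) ^@ q) ((D e2 (D e2 g)) ^@ q) + dot ((D e2 (D e1 g)) ^@ q) ((D e2 g) ^@ q) = 0.
    by rewrite addrC; exact: (dot_derive e2 s1 s2 D12 Uq).
  have H := Yd q ((D e2 g) ^@ q) Uq.
  rewrite dotC; exact: other E H (Y2 q Uq).
(* [Y1] is differentiated along [e2] and [Z1] along [e1]; the third derivatives agree by symmetry
   and cancel. *)
have G : dot ((D e1 (D e1 g)) ^@ p) ((D e2 (D e2 g)) ^@ p) =
         dot ((D e1 (D e2 g)) ^@ p) ((D e1 (D e2 g)) ^@ p).
  have alg (a b c d x y : R) : a + b = 0 -> c + d = 0 -> a = c -> b = x -> d = y -> y = x.
    by move=> Ea Ec ac bx dy; move: Ea Ec; rewrite ac bx dy; lra.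
  have E1 := dot_derive e2 (sD e1 s2) s1 Y1 Up.
  have E2 := dot_derive e1 (sD e2 s2) s1 Z1 Up.
  have E3 : dot ((D e2 (D e1 (D e2 g))) ^@ p) ((D e1 g) ^@ p) =
            dot ((D e1 (D e2 (D e2 g))) ^@ p) ((D e1 g) ^@ p).
    exact: (dot_congrl _ (fun i => smooth_commD e1 e2 oU (s2 i) Up)).
  have E4 : dot ((D e1 (D e2 g)) ^@ p) ((D e2 (D e1 g)) ^@ p) =
            dot ((D e1 (D e2 g)) ^@ p) ((D e1 (D e2 g)) ^@ p).
    exact: (dot_congrr _ (fun i => C i p Up)).
  have E5 := dotC ((D e1 (D e1 g)) ^@ p) ((D e2 (D e2 g)) ^@ p).
  have H := alg _ _ _ _ _ _ E1 E2 E3 E4 (esym E5).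
  exact: H.
pose n := cross ((D e1 g) ^@ p) ((D e2 g) ^@ p).
have nX := normal_span (D11 Up) (D22 Up) (D12 Up) (X1 _ Up) (X2 _ Up).
have nY := normal_span (D11 Up) (D22 Up) (D12 Up) (Y1 _ Up) (Y2 _ Up).
have nZ := normal_span (D11 Up) (D22 Up) (D12 Up) (Z1 _ Up) (Z2 _ Up).
exists n, (dot ((D e1 (D e1 g)) ^@ p) n), (dot ((D e1 (D e2 g)) ^@ p) n), (dot ((D e2 (D e2 g)) ^@ p) n).
split.
  have nn : dot n n = 1 by exact: cross_unit (D11 Up) (D22 Up) (D12 Up).
  have alg (a b : 'I_3 -> R) (x y : R) : (forall i, a i = x * n i) -> (forall i, b i = y * n i) ->
      dot a b = x * y.
    by move=> Ea Eb; rewrite -[RHS]mulr1 -nn !dotE !Ea !Eb; ring.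
  exact: etrans (esym (alg _ _ _ _ nX nZ)) (etrans G (alg _ _ _ _ nY nY)).
move=> i u v.
have alg (L a b c x y z m u1 u2 v1 v2 : R) : L = u1 * v1 * a + (u1 * v2 + u2 * v1) * b + u2 * v2 * c ->
    a = x * m -> b = y * m -> c = z * m -> L = m * (u1 * v1 * x + (u1 * v2 + u2 * v1) * y + u2 * v2 * z).
  by move=> -> -> -> ->; ring.
exact: alg (hessian_bilinear u v (sg i) Up) (nX i) (nY i) (nZ i).
Qed.

(** The Hessians of all coordinates are multiples, by the coordinates of [n], of one scalar form. *)
Lemma hessian_parallel i j u v u' v' p : U p ->
  'D_u ('D_v (g i)) p * 'D_u' ('D_v' (g j)) p = 'D_u' ('D_v' (g i)) p * 'D_u ('D_v (g j)) p.
Proof.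
move=> Up; have [n [x [y [z [_ E]]]]] := second_fundamental_form Up.
have alg (a b c d m m' s t : R) : a = m * s -> b = m' * t -> c = m * t -> d = m' * s -> a * b = c * d.
  by move=> -> -> -> ->; ring.
exact: alg (E i u v) (E j u' v') (E i u' v') (E j u v).
Qed.

(** Passing to the frame [v], [u] multiplies the determinant [x * z - y * y] by the square of the
    determinant of the frame. *)
Lemma hessian_degenerate i u v p : U p ->
  'D_v ('D_v (g i)) p * 'D_u ('D_u (g i)) p = 'D_v ('D_u (g i)) p * 'D_v ('D_u (g i)) p.
Proof.
move=> Up; have [n [x [y [z [xz E]]]]] := second_fundamental_form Up.
have alg (A B C u1 u2 v1 v2 m : R) : A = m * (v1 * v1 * x + (v1 * v2 + v2 * v1) * y + v2 * v2 * z) ->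
    C = m * (u1 * u1 * x + (u1 * u2 + u2 * u1) * y + u2 * u2 * z) ->
    B = m * (v1 * u1 * x + (v1 * u2 + v2 * u1) * y + v2 * u2 * z) -> A * C = B * B.
  move=> -> -> ->; rewrite -[RHS]addr0.
  rewrite -[X in _ = _ + X](_ : m ^+ 2 * (v1 * u2 - v2 * u1) ^+ 2 * (x * z - y * y) = 0).
    by ring.
  by rewrite xz subrr mulr0.
exact: alg (E i v v) (E i u u) (E i v u).
Qed.

Lemma hessian_scale i u v (k : R) p : U p ->
  'D_(k *: v) ('D_u (g i)) p = k * 'D_v ('D_u (g i)) p.
Proof.
move=> Up; have [n [x [y [z [_ E]]]]] := second_fundamental_form Up.
have alg (A B u1 u2 v1 v2 m : R) : A = m * ((k * v1) * u1 * x + ((k * v1) * u2 + (k * v2) * u1) * y + (k * v2) * u2 * z) ->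
    B = m * (v1 * u1 * x + (v1 * u2 + v2 * u1) * y + v2 * u2 * z) -> A = k * B.
  by move=> -> ->; ring.
exact: alg (E i (k *: v) u) (E i v u).
Qed.

(** [codazzi_line] handles the coordinate [i0], with the Hessian entries in the frame [k *: v], [u];
    [hessian_parallel] carries the vanishing over to the other coordinates. *)
Lemma ruling i0 u v p q (k : R) : (forall s, 0 <= s <= 1 -> U (s *: (k *: v) + p)) -> q = k *: v + p ->
  (forall i, 'D_v ('D_u (g i)) p = 0) -> 'D_u ('D_u (g i0)) p != 0 ->
  (forall i, 'D_v ('D_v (g i)) q = 0 /\ 'D_v ('D_u (g i)) q = 0) /\ 'D_u ('D_u (g i0)) q != 0.
Proof.
move=> Us qE Bp Cp.
suff [Bq Cq] : 'D_v ('D_u (g i0)) q = 0 /\ 'D_u ('D_u (g i0)) q != 0.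
  have Uq : U q by have := Us 1; rewrite ler01 lexx scale1r -qE; apply.
  have zero (a b c d : R) : a * b = c * d -> b != 0 -> d = 0 -> a = 0.
    by move=> E b0 d0; move/eqP: E; rewrite d0 mulr0 mulf_eq0 (negPf b0) orbF => /eqP.
  split; last exact: Cq.
  move=> i.
  have Bi : 'D_v ('D_u (g i)) q = 0.
    exact: zero (hessian_parallel i i0 v u u u Uq) Cq Bq.
  split; last exact: Bi.
  have Aq : 'D_v ('D_v (g i0)) q = 0.
    exact: zero (hessian_degenerate i0 u v Uq) Cq Bq.
  exact: zero (hessian_parallel i i0 v v u u Uq) Cq Aq.
(* Returning from [k *: v] to [v] requires division by [k]. *)
have [k0|k0] := eqVneq k 0.
  by have -> : q = p; [rewrite qE k0 scale0r add0r | split].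
have Up : U p by have := Us 0; rewrite lexx ler01 scale0r add0r; apply.
have sw := sg i0.
have sA := smooth_D (k *: v) oU (smooth_D (k *: v) oU sw).
have sB := smooth_D (k *: v) oU (smooth_D u oU sw).
have sC := smooth_D u oU (smooth_D u oU sw).
have DA x : U x -> _ := fun Ux => smooth_commD_vvu u (k *: v) oU sw Ux.
have DB x : U x -> _ := fun Ux => smooth_commD (k *: v) u oU (smooth_D u oU sw) Ux.
have AC x : U x -> _ := fun Ux => hessian_degenerate i0 u (k *: v) Ux.
have Bp' : 'D_(k *: v) ('D_u (g i0)) p = 0.
  exact: etrans (hessian_scale i0 u v k Up) (etrans (congr1 (fun x => k * x) (Bp i0)) (mulr0 k)).
have := codazzi_line oU sA sB sC DA DB AC ler01 Us Bp' Cp.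
rewrite scale1r -qE => -[Bq Cq]; split; last exact: Cq.
have Uq : U q by have := Us 1; rewrite ler01 lexx scale1r -qE; apply.
have := etrans (esym (hessian_scale i0 u v k Uq)) Bq.
by move/eqP; rewrite mulf_eq0 (negPf k0) => /eqP.
Qed.

End FlatSurface.

(** * The family of bends *)

Section McShane.
Context {R : realType}.

(* The average of the least and the greatest Lipschitz extension commutes with
   the symmetry [(x, t) -> (x + lam, - t)], which each of them alone does not. *)
Lemma lipschitz_extension_antiperiodic (K : set R) (t0 : R -> R) (L lam : R) :
  0 <= L -> K !=set0 ->
  (forall k l, K k -> K l -> `|t0 k - t0 l| <= L * `|k - l|) ->
  (forall k, K k <-> K (k + lam)) -> (forall k, K k -> t0 (k + lam) = - t0 k) ->
  exists t : R -> R, [/\ forall k, K k -> t k = t0 k,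
    forall x y, `|t x - t y| <= L * `|x - y| & forall x, t (x + lam) = - t x].
Proof.
move=> L0 [k0 Kk0] lip Kl tl.
(* The infimum of [I x] is the greatest and the supremum of [S x] the least extension with constant
   [L]. *)
pose I x := [set t0 k + L * `|x - k| | k in K].
pose S x := [set t0 k - L * `|x - k| | k in K].
have SI x k l : K k -> K l -> t0 k - L * `|x - k| <= t0 l + L * `|x - l|.
  move=> Kk Kll; have := lip _ _ Kk Kll.
  have : L * `|k - l| <= L * (`|x - k| + `|x - l|).
    apply: ler_wpM2l => //; rewrite (_ : k - l = - (x - k) + (x - l)); last by ring.
    by apply: (le_trans (ler_normD _ _)); rewrite normrN.
  by rewrite mulrDr; have := ler_norm (t0 k - t0 l); lra.
have I0 x : I x !=set0 by exists (t0 k0 + L * `|x - k0|); exists k0.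
have S0 x : S x !=set0 by exists (t0 k0 - L * `|x - k0|); exists k0.
have hI x : has_lbound (I x).
  by exists (t0 k0 - L * `|x - k0|) => _ [k Kk <-]; exact: SI.
have hS x : has_ubound (S x).
  by exists (t0 k0 + L * `|x - k0|) => _ [k Kk <-]; exact: SI.
have step (x y k : R) : L * `|x - k| <= L * `|y - k| + L * `|x - y|.
  rewrite -mulrDr; apply: ler_wpM2l => //; rewrite (_ : x - k = (y - k) + (x - y)); last by ring.
  exact: ler_normD.
have lI x y : inf (I x) <= inf (I y) + L * `|x - y|.
  rewrite -lerBlDr; apply: lb_le_inf => // _ [k Kk <-]; rewrite lerBlDr -addrA.
  apply: (@le_trans _ _ (t0 k + L * `|x - k|)); first by apply: ge_inf => //; exists k.
  by rewrite lerD2l.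
have lS x y : sup (S x) <= sup (S y) + L * `|x - y|.
  apply: ge_sup => // _ [k Kk <-]; rewrite -lerBlDr.
  apply: (@le_trans _ _ (t0 k - L * `|y - k|)); last by apply: ub_le_sup => //; exists k.
  by have := step y x k; rewrite [`|y - x|]distrC; lra.
exists (fun x => (inf (I x) + sup (S x)) / 2); split.
- move=> k Kk.
  have -> : inf (I k) = t0 k.
    apply/eqP; rewrite eq_le; apply/andP; split.
      by apply: ge_inf => //; exists k => //; rewrite subrr normr0 mulr0 addr0.
    apply: lb_le_inf => // _ [l Kll <-].
    by have := SI k k l Kk Kll; rewrite subrr normr0 mulr0 subr0.
  have -> : sup (S k) = t0 k.
    apply/eqP; rewrite eq_le; apply/andP; split.
      apply: ge_sup => // _ [l Kll <-].
      by have := SI k l k Kll Kk; rewrite subrr normr0 mulr0 addr0.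
    by apply: ub_le_sup => //; exists k => //; rewrite subrr normr0 mulr0 subr0.
  by lra.
- move=> x y; rewrite ler_norml.
  have := lI x y; have := lI y x; have := lS x y; have := lS y x.
  by rewrite [`|y - x|]distrC; move: (L * _) => d *; apply/andP; split; lra.
- move=> x.
  (* Translation by [lam] exchanges the two families up to sign, so the average changes sign. *)
  have E1 : I (x + lam) = -%R @` S x.
    apply/seteqP; split => [_ [k Kk <-]|_ [_ [k Kk <-] <-]].
      have Kk' : K (k - lam) by apply/Kl; rewrite subrK.
      exists (t0 (k - lam) - L * `|x - (k - lam)|); first by exists (k - lam).
      have := tl _ Kk'; rewrite subrK => ->.
      by rewrite (_ : x + lam - k = x - (k - lam)); ring.
    exists (k + lam); first exact: (Kl k).1.
    by rewrite tl// (_ : x + lam - (k + lam) = x - k); ring.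
  have E2 : S (x + lam) = -%R @` I x.
    apply/seteqP; split => [_ [k Kk <-]|_ [_ [k Kk <-] <-]].
      have Kk' : K (k - lam) by apply/Kl; rewrite subrK.
      exists (t0 (k - lam) + L * `|x - (k - lam)|); first by exists (k - lam).
      have := tl _ Kk'; rewrite subrK => ->.
      by rewrite (_ : x + lam - k = x - (k - lam)); ring.
    exists (k + lam); first exact: (Kl k).1.
    by rewrite tl// (_ : x + lam - (k + lam) = x - k); ring.
  have opp2 (A : set R) : -%R @` (-%R @` A) = A.
    apply/seteqP; split => [_ [_ [y Ay <-] <-]|y Ay]; first by rewrite opprK.
    by exists (- y); [exists y | rewrite opprK].
  have supN (A : set R) : sup (-%R @` A) = - inf A by rewrite /inf opprK.
  by rewrite E1 E2 supN /inf opp2; lra.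
Qed.
End McShane.

(** * Affine behaviour along lines and passage to the closed strip *)

Section AffineLine.
Context {R : realType} (U : set (R * R)) (f : R * R -> R).
Hypotheses (oU : open U) (sf : smooth_on U f).

(** The ends of the segment may lie on the boundary of the strip, where only continuity is
    available; the mean value theorem needs no more than that there. *)
Lemma affine_along (p v : R * R) (a b : R) : a < b ->
  (forall s, a < s < b -> U (s *: v + p)) ->
  (forall s, a < s < b -> 'D_v ('D_v f) (s *: v + p) = 0) ->
  {within `[a, b], continuous (fun s : R => f (s *: v + p))} ->
  exists c, (forall s, a < s < b -> 'D_v f (s *: v + p) = c) /\
    forall s, a <= s <= b -> f (s *: v + p) = f (a *: v + p) + c * (s - a).
Proof.
move=> ab Us D0 fc; pose m := (a + b) / 2.
have mab : a < m < b by rewrite /m; lra.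
have C s t : a < s -> s <= t -> t < b -> 'D_v f (s *: v + p) = 'D_v f (t *: v + p).
  move=> sa st tb.
  have I x : s <= x <= t -> a < x < b by lra.
  have d x : s <= x <= t -> is_derive x (1 : R) (fun s : R => 'D_v f (s *: v + p)) 0.
    move=> /I xI; rewrite -(D0 x xI).
    exact: (derive_line_smooth oU (smooth_D v oU sf) (Us x xI)).
  apply: (@derive_zero_const R (fun s : R => 'D_v f (s *: v + p)) s t st) => x xI.
    exact: is_derive_continuous (d x xI).
  by apply: d; lra.
have Cm s : a < s < b -> 'D_v f (s *: v + p) = 'D_v f (m *: v + p).
  move=> /andP[sa sb]; have [sm|ms] := leP s m.
    by apply: C => //; case/andP: mab.
  by apply/esym; apply: C => //; [case/andP: mab | exact: ltW].
exists ('D_v f (m *: v + p)); split; first exact: Cm.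
move=> s /andP[sa sb]; have [<-|sa'] := eqVneq a s; first by rewrite subrr mulr0 addr0.
have as' : a < s by rewrite lt_neqAle sa'.
have d x : x \in `]a, s[%R -> is_derive x (1 : R) (fun s : R => f (s *: v + p)) ('D_v f (x *: v + p)).
  rewrite in_itv /= => /andP[ax xs].
  by apply: (derive_line_smooth oU sf); apply: Us; rewrite ax (lt_le_trans xs).
have fc' : {within `[a, s], continuous (fun s : R => f (s *: v + p))}.
  by apply: continuous_subspaceW fc; apply: subset_itvl.
have [x xI E] := MVT as' d fc'.
have xab : a < x < b by move: xI; rewrite in_itv /=; lra.
by rewrite -(Cm x xab) -E [RHS]addrC subrK.
Qed.

End AffineLine.

(** If [h y] exceeded [k], so would [h] at a point moved slightly from [y] towards the midpoint
    [2^-1], and that point is interior. *)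
Lemma le_closure_itv {R : realType} (h : R -> R) (k y : R) : {within `[0, 1], continuous h} ->
  (forall y : R, 0 < y < 1 -> h y <= k) -> 0 <= y <= 1 -> h y <= k.
Proof.
move=> hc hk yI; rewrite leNgt; apply/negP => ky.
have /subspace_continuousP /(_ y) := hc.
rewrite /= in_itv /= => /(_ yI) /cvgrPdist_lt /(_ (h y - k)).
rewrite subr_gt0 => /(_ ky).
rewrite near_withinE => /nbhs_normP[e /= e0 He].
pose r := Num.min 1 (e / 2).
have r0 : 0 < r by rewrite lt_min ltr01 divr_gt0.
have r1 : r <= 1 by rewrite ge_min lexx.
have re : r < e by rewrite gt_min; apply/orP; right; lra.
have yr : `|y - (y + r * (2^-1 - y))| < e.
  rewrite opprD addNKr normrN normrM (gtr0_norm r0).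
  have : `|2^-1 - y| <= 1 by rewrite ler_norml; lra.
  by move=> H; apply: le_lt_trans re; rewrite -[leRHS]mulr1 ler_wpM2l// ltW.
have [] := andP yI => y0 y1.
have rI : 0 < y + r * (2^-1 - y) < 1.
  have -> : y + r * (2^-1 - y) = (1 - r) * y + r / 2 by ring.
  have : 0 <= (1 - r) * y by rewrite mulr_ge0// subr_ge0.
  have : (1 - r) * y <= 1 - r by rewrite -[leRHS]mulr1 ler_wpM2l// subr_ge0.
  by lra.
have := hk _ rI; have := He _ yr; move: (y + _) rI => z zI; rewrite /= in_itv /=.
have -> : 0 <= z <= 1 by lra.
by move=> /(_ isT); rewrite /from_subspace ltr_norml => /andP[_]; lra.
Qed.

(** * Null lines of the second fundamental form on the strip *)

Section StripLemmas.
Context {R : realType} (lam : R) (g : 'I_3 -> R * R -> R).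
Let U : set (R * R) := [set p | 0 < p.2 < 1].
Hypothesis lam0 : 0 < lam.
Hypothesis sg : forall i, smooth_on U (g i).
Local Notation D v f := (fun i => 'D_v (f i)).
Local Notation "f ^@ p" := (fun i => f i p) (at level 10).
Hypothesis D11 : forall p, U p -> dot ((D e1 g) ^@ p) ((D e1 g) ^@ p) = 1.
Hypothesis D22 : forall p, U p -> dot ((D e2 g) ^@ p) ((D e2 g) ^@ p) = 1.
Hypothesis D12 : forall p, U p -> dot ((D e1 g) ^@ p) ((D e2 g) ^@ p) = 0.
Hypothesis deck : forall i (x y : R), 0 <= y <= 1 -> g i (x + lam, y) = g i (x, 1 - y).
Hypothesis gcont : forall i (p : R * R), 0 <= p.2 <= 1 ->
  g i @ within [set q : R * R | 0 <= q.2 <= 1] (nbhs p) --> g i p.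
Implicit Types (p q u v : R * R) (t x y : R).

Lemma open_strip : open U.
Proof.
have -> : U = snd @^-1` `]0, 1[%classic by apply/seteqP; split => p; rewrite /U /= in_itv.
by apply: open_comp; [move=> p _; exact: cvg_snd | exact: itv_open].
Qed.

Let dirE (w : R * R -> R) v p : smooth_on U w -> U p ->
  'D_v w p = v.1 * 'D_e1 w p + v.2 * 'D_e2 w p.
Proof. by move=> sw Up; exact: (smooth_deriveE v open_strip sw Up). Qed.

Let sff := second_fundamental_form open_strip sg dirE D11 D22 D12.
Let scale := hessian_scale open_strip sg dirE D11 D22 D12.
Let rul := ruling open_strip sg dirE D11 D22 D12.

(** The entry for [e1] alone decides whether the form vanishes: [not_bent_flat] rules out a nonzero
    form with horizontal null direction. *)
Definition bent p := exists i, 'D_e1 ('D_e1 (g i)) p != 0.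
(** Null directions are given by inverse slope. At a bent point the form is degenerate and nonzero
    on [e1], so pairing with [e1] already detects its kernel. *)
Definition null p t := forall i, 'D_((t, 1) : R * R) ('D_e1 (g i)) p = 0.

Lemma null_exists p : U p -> bent p -> exists t, null p t.
Proof.
move=> Up [i0 b0]; have [n [x [y [z [xz E]]]]] := sff Up.
have x0 : x != 0.
  apply: contraNneq b0 => x0.
  have alg (a m : R) : a = m * (1 * 1 * x + (1 * 0 + 0 * 1) * y + 0 * 0 * z) -> a = 0.
    by move=> ->; rewrite x0; ring.
  by apply/eqP; exact: alg (E i0 e1 e1).
exists (- y / x) => i.
have alg (a m : R) : a = m * (- y / x * 1 * x + (- y / x * 0 + 1 * 1) * y + 1 * 0 * z) -> a = 0.
  by move=> ->; field.
exact: alg (E i (- y / x, 1) e1).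
Qed.

Lemma null_unique p t t' : U p -> bent p -> null p t -> null p t' -> t = t'.
Proof.
move=> Up [i0 b0] nt nt'; have [n [x [y [z [xz E]]]]] := sff Up.
have alg (a b c m : R) : a = m * (1 * 1 * x + (1 * 0 + 0 * 1) * y + 0 * 0 * z) ->
    b = m * (t * 1 * x + (t * 0 + 1 * 1) * y + 1 * 0 * z) ->
    c = m * (t' * 1 * x + (t' * 0 + 1 * 1) * y + 1 * 0 * z) ->
    a != 0 -> b = 0 -> c = 0 -> t = t'.
  move=> -> -> -> a0 b1 c1; apply/eqP; rewrite -subr_eq0.
  have /eqP : (t - t') * (m * (1 * 1 * x + (1 * 0 + 0 * 1) * y + 0 * 0 * z)) = 0.
    transitivity (m * (t * 1 * x + (t * 0 + 1 * 1) * y + 1 * 0 * z) -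
       m * (t' * 1 * x + (t' * 0 + 1 * 1) * y + 1 * 0 * z)); first by ring.
    by rewrite b1 c1 subrr.
  by rewrite mulf_eq0 (negPf a0) orbF.
exact: alg (E i0 e1 e1) (E i0 (t, 1) e1) (E i0 (t', 1) e1) b0 (nt i0) (nt' i0).
Qed.

Lemma bent_line p t s : U p -> bent p -> null p t -> 0 < p.2 + s < 1 ->
  let q := s *: ((t, 1) : R * R) + p in
  [/\ bent q, null q t & forall i, 'D_((t, 1) : R * R) ('D_((t, 1) : R * R) (g i)) q = 0].
Proof.
move=> Up [i0 b0] nt ps q.
have Us r : 0 <= r <= 1 -> U (r *: (s *: ((t, 1) : R * R)) + p).
  move=> /andP[r0 r1]; rewrite /U /= /GRing.scale /= mulr1.
  have [p0 p1] := andP Up; have [ps0 ps1] := andP ps.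
  rewrite (_ : r * s + p.2 = (1 - r) * p.2 + r * (p.2 + s)); last by ring.
  have [->|rn0] := eqVneq r 0; first by lra.
  have rp : 0 < r by rewrite lt_neqAle eq_sym rn0.
  have : 0 < r * (p.2 + s) by rewrite mulr_gt0.
  have : 0 <= (1 - r) * p.2 by rewrite mulr_ge0; lra.
  have : r * (p.2 + s) < r by rewrite -[ltRHS]mulr1 ltr_pM2l.
  have : (1 - r) * p.2 <= 1 - r by rewrite -[leRHS]mulr1 ler_wpM2l; lra.
  by lra.
have [H bq] := rul Us (erefl q) nt b0.
split; [by exists i0 | by move=> i; have [] := H i | by move=> i; have [] := H i].
Qed.

(** The deck transformation that generates the gluing; [dsigma] is its differential. *)
Let sigma p : R * R := (p.1 + lam, 1 - p.2).
Let dsigma v : R * R := (v.1, - v.2).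

Let sigmaU p : U p -> U (sigma p).
Proof. by rewrite /U /sigma /=; lra. Qed.

Let derive_sigma (w : R * R -> R) v p : smooth_on U w -> U p ->
  'D_v (fun q => w (sigma q)) p = 'D_(dsigma v) w (sigma p).
Proof.
move=> sw Up.
suff [_ ->] : is_derive p v (fun q => w (sigma q)) ('D_(dsigma v) w (sigma p)) by [].
apply: (is_derive_affine (s := sigma) (u' := dsigma v)).
  by move=> h; apply: pair_ext; rewrite /sigma /dsigma /= /GRing.scale /=; ring.
exact: (smooth_is_derive _ open_strip sw (sigmaU Up)).
Qed.

Lemma hessian_deck i u v p : U p ->
  'D_u ('D_v (g i)) p = 'D_(dsigma u) ('D_(dsigma v) (g i)) (sigma p).
Proof.
move=> Up.
have E q : U q -> g i q = g i (sigma q).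
  case: q => x y; rewrite /U /sigma /= => yI.
  by rewrite deck; [congr g; congr pair; ring | lra].
have E' q : U q -> 'D_v (g i) q = 'D_(dsigma v) (g i) (sigma q).
  move=> Uq; exact: etrans (derive_congr v open_strip E Uq) (derive_sigma v (sg i) Uq).
have H1 : 'D_u ('D_v (g i)) p = 'D_u (fun q => 'D_(dsigma v) (g i) (sigma q)) p.
  exact: (derive_congr u open_strip E' Up).
rewrite H1; exact: (derive_sigma u (smooth_D (dsigma v) open_strip (sg i)) Up).
Qed.

Let dsigma1 : dsigma e1 = e1.
Proof. by apply: pair_ext => //=; rewrite oppr0. Qed.

Lemma bent_deck p : U p -> bent p <-> bent (sigma p).
Proof.
move=> Up; have E i := hessian_deck i e1 e1 Up; rewrite dsigma1 in E.
by split=> -[i bi]; exists i; move: bi; rewrite E.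
Qed.

(** The differential maps [(t, 1)] to [(t, - 1)], which spans the same line as [(- t, 1)]. *)
Lemma null_deck p t : U p -> null p t -> null (sigma p) (- t).
Proof.
move=> Up nt i; have := hessian_deck i (t, 1) e1 Up; rewrite dsigma1 (nt i).
have -> : dsigma (t, 1) = (-1) *: ((- t, 1) : R * R).
  by apply: pair_ext; rewrite /= /GRing.scale /=; ring.
move=> /esym H; have := etrans (esym (scale i e1 (- t, 1) (-1) (sigmaU Up))) H.
by move/eqP; rewrite mulN1r oppr_eq0 => /eqP.
Qed.

Lemma strip_shift p s : U p -> U (s *: e1 + p).
Proof. by rewrite /U /= /GRing.scale /= mulr0 add0r. Qed.

(* A line mapped with unit speed onto a straight line is not periodic. *)
Lemma horizontal_curved p : U p -> ~ (forall i s, 'D_e1 ('D_e1 (g i)) (s *: e1 + p) = 0).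
Proof.
move=> Up H0.
have l2 : 0 < 2 * lam by rewrite mulr_gt0.
have Z i : 'D_e1 (g i) (lam *: e1 + p) = 0.
  have cont : {within `[0, 2 * lam], continuous (fun s : R => g i (s *: e1 + p))}.
    apply: within_continuous => s _.
    exact: is_derive_continuous (derive_line_smooth open_strip (sg i) (strip_shift s Up)).
  have [c [Dc gc]] := affine_along open_strip (sg i) l2 (fun s _ => strip_shift s Up)
    (fun s _ => H0 i s) cont.
  rewrite Dc; last by have := lam0; lra.
  have := gc (2 * lam); rewrite (ltW l2) lexx => /(_ isT).
  (* Two deck transformations compose to the horizontal translation by [2 * lam], so the slope [c]
     is zero, contrary to unit speed. *)
  have -> : (2 * lam) *: e1 + p = (p.1 + lam + lam, p.2).
    by apply: pair_ext; rewrite /= /GRing.scale /=; ring.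
  have [p0 p1] := andP Up.
  rewrite deck; last by rewrite !ltW.
  rewrite deck; last by lra.
  rewrite (_ : (p.1, 1 - (1 - p.2)) = 0 *: e1 + p); last first.
    by apply: pair_ext; rewrite /= /GRing.scale /=; ring.
  move=> /eqP; rewrite subr0 -subr_eq0 opprD addNKr oppr_eq0 mulf_eq0 [2 * lam == 0]gt_eqF// orbF.
  by move/eqP.
have := D11 (strip_shift lam Up); rewrite dotE /= !Z => /eqP.
by rewrite !mul0r !addr0 eq_sym oner_eq0.
Qed.

(** A degenerate form that vanishes on [e1] has only the entry for [e2] left. Were it nonzero, [e1]
    would be a null direction and [ruling] would make the whole horizontal line straight. *)
Lemma not_bent_flat p u v i : U p -> ~ bent p -> 'D_u ('D_v (g i)) p = 0.
Proof.
move=> Up nb; have [n [x [y [z [xz E]]]]] := sff Up.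
have nx j : n j * x = 0.
  have /eqP N : 'D_e1 ('D_e1 (g j)) p == 0 by apply: contrapT => /negP ?; apply: nb; exists j.
  have alg (a m : R) : a = m * (1 * 1 * x + (1 * 0 + 0 * 1) * y + 0 * 0 * z) -> a = 0 -> m * x = 0.
    by move=> -> <-; ring.
  exact: alg (E j e1 e1) N.
apply: contrapT => H.
have n0 : n i != 0 by apply: contra_notN H => /eqP n0; rewrite E n0 mul0r.
have x0 : x = 0 by have /eqP := nx i; rewrite mulf_eq0 (negPf n0) => /eqP.
have y0 : y = 0 by move/eqP: xz; rewrite x0 mul0r eq_sym mulf_eq0 orbb => /eqP.
have H12 j : 'D_e1 ('D_e2 (g j)) p = 0.
  have alg (a m : R) : a = m * (1 * 0 * x + (1 * 1 + 0 * 0) * y + 0 * 1 * z) -> a = 0.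
    by move=> ->; rewrite x0 y0; ring.
  exact: alg (E j e1 e2).
have H22 : 'D_e2 ('D_e2 (g i)) p != 0.
  have alg (a b m u1 u2 v1 v2 : R) : a = m * (0 * 0 * x + (0 * 1 + 1 * 0) * y + 1 * 1 * z) ->
      b = m * (u1 * v1 * x + (u1 * v2 + u2 * v1) * y + u2 * v2 * z) -> b <> 0 -> a != 0.
    move=> -> -> b0; apply: contra_not_neq b0 => a0.
    by transitivity (u2 * v2 * (m * (0 * 0 * x + (0 * 1 + 1 * 0) * y + 1 * 1 * z)));
      [rewrite x0 y0; ring | rewrite a0 mulr0].
  exact: alg (E i e2 e2) (E i u v) H.
apply: (horizontal_curved Up) => j s.
have Us r : 0 <= r <= 1 -> U (r *: (s *: e1) + p).
  by move=> _; rewrite scalerA; exact: strip_shift.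
have [B _] := rul Us erefl H12 H22.
exact: (B j).1.
Qed.

Lemma exists_bent : exists x, bent (x, 2^-1).
Proof.
have Up : U (0, 2^-1) by rewrite /U /=; lra.
apply: contrapT => nb; apply: (horizontal_curved Up) => i s.
have E : s *: e1 + (0, 2^-1) = (s, 2^-1) :> R * R.
  by apply: pair_ext; rewrite /= /GRing.scale /=; ring.
rewrite E; apply: not_bent_flat; first by rewrite /U /=; lra.
by move=> b; apply: nb; exists s.
Qed.

(** Otherwise the two null lines would cross at height [2^-1 + s] inside the strip, and the null
    direction at a bent point is unique. *)
Lemma null_lipschitz x x' t t' : bent (x, 2^-1) -> bent (x', 2^-1) ->
  null (x, 2^-1) t -> null (x', 2^-1) t' -> `|t - t'| <= 2 * `|x - x'|.
Proof.
move=> bx bx' nt nt'; rewrite leNgt; apply/negP => lt.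
have Um y : U (y, 2^-1) by rewrite /U /=; lra.
have tt' : t - t' != 0 by apply: contraTneq lt => ->; rewrite normr0 -leNgt mulr_ge0.
pose s := (x' - x) / (t - t').
have sI : `|s| < 2^-1.
  rewrite /s normrM normfV ltr_pdivrMr ?normr_gt0// distrC; lra.
have sI' : 0 < ((x, 2^-1) : R * R).2 + s < 1 by move: sI; rewrite ltr_norml /=; lra.
have [bq nq _] := bent_line (Um x) bx nt sI'.
have [bq' nq' _] := bent_line (Um x') bx' nt' sI'.
have E : s *: ((t, 1) : R * R) + (x, 2^-1) = s *: ((t', 1) : R * R) + (x', 2^-1).
  apply: pair_ext; rewrite /= /GRing.scale //= /s.
  by field.
have Uq : U (s *: ((t', 1) : R * R) + (x', 2^-1)).
  by move: sI'; rewrite /U /= /GRing.scale /= mulr1 addrC.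
rewrite E in bq nq.
by move/eqP: tt'; rewrite (null_unique Uq bq nq nq') subrr.
Qed.

(** The slopes at the bent points [K] of the centre line are extended to all abscissae. At a bent
    point [q] of an extended segment, the null line through [q] reaches the centre line at a point
    of [K], and the Lipschitz bound identifies the two lines; at other points the form is zero. *)
Lemma bend_family : exists t : R -> R, [/\ forall x y, `|t x - t y| <= 2 * `|x - y|,
  forall x, t (x + lam) = - t x &
  forall x s i, 0 < 2^-1 + s < 1 ->
    'D_((t x, 1) : R * R) ('D_((t x, 1) : R * R) (g i)) (s *: ((t x, 1) : R * R) + (x, 2^-1)) = 0].
Proof.
have Um y : U (y, 2^-1) by rewrite /U /=; lra.
have half : 1 - 2^-1 = 2^-1 :> R by lra.
pose K := [set x | bent (x, 2^-1)].
pose t0 x := xget 0 [set t | null (x, 2^-1) t].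
have t0P x : K x -> null (x, 2^-1) (t0 x).
  by move=> /(null_exists (Um x))[t nt]; rewrite /t0; case: xgetP => // /(_ t).
have Kl k : K k <-> K (k + lam).
  by rewrite /K /= (bent_deck (Um k)) /sigma /= half.
have tl k : K k -> t0 (k + lam) = - t0 k.
  move=> Kk; have Kkl := (Kl k).1 Kk.
  apply: (null_unique (Um (k + lam)) Kkl (t0P _ Kkl)).
  by have := null_deck (Um k) (t0P _ Kk); rewrite /sigma /= half.
have lip k l : K k -> K l -> `|t0 k - t0 l| <= 2 * `|k - l|.
  by move=> Kk Kll; exact: null_lipschitz Kk Kll (t0P _ Kk) (t0P _ Kll).
have [t [tK tlip tanti]] := lipschitz_extension_antiperiodic (ler0n R 2) exists_bent lip Kl tl.
exists t; split => // x s i sI.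
pose q : R * R := s *: ((t x, 1) : R * R) + (x, 2^-1).
have qE : q = (s * t x + x, s + 2^-1).
  by apply: pair_ext; rewrite /= /GRing.scale //= mulr1.
have Uq : U q by rewrite qE /U /=; lra.
have [bq|nbq] := pselect (bent q); last exact: (not_bent_flat _ _ _ Uq nbq).
have [u nu] := null_exists Uq bq.
have s2 : 0 < q.2 + - s < 1 by rewrite qE /=; lra.
(* The abscissa where the null line through [q] meets the centre line. *)
pose x1 := s * t x + x - s * u.
have E1 : - s *: ((u, 1) : R * R) + q = (x1, 2^-1).
  by rewrite qE; apply: pair_ext; rewrite /= /GRing.scale /= /x1; ring.
have [b1 n1 _] := bent_line Uq bq nu s2; rewrite E1 in b1 n1.
have t1 : t x1 = u by rewrite tK//; exact: null_unique (Um x1) b1 (t0P _ b1) n1.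
(* Both lines pass through [q], so [|x - x1| = |s| |t x - t x1| <= 2 |s| |x - x1|], while
   [2 |s| < 1]. *)
have xx1 : x = x1.
  apply/eqP; rewrite -subr_eq0 -normr_le0 leNgt; apply/negP => d0.
  have := tlip x x1; rewrite t1.
  have : `|x - x1| = `|s| * `|t x - u| by rewrite -normrM -normrN /x1; congr `|_|; ring.
  have s1 : `|s| < 2^-1 by rewrite ltr_norml; lra.
  move=> E le; have : `|x - x1| <= `|s| * (2 * `|x - x1|) by rewrite {1}E ler_wpM2l.
  have : `|s| * `|x - x1| < 2^-1 * `|x - x1| by rewrite ltr_pM2r.
  by rewrite mulrCA; lra.
have tu : t x = u by rewrite xx1.
have q0 : 0 < q.2 + 0 < 1 by rewrite addr0.
have [_ _ H] := bent_line Uq bq nu q0.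
by have := H i; rewrite scale0r add0r -tu.
Qed.

Lemma continuous_line i p v (a b : R) : (forall s, a <= s <= b -> 0 <= (s *: v + p).2 <= 1) ->
  {within `[a, b], continuous (fun s : R => g i (s *: v + p))}.
Proof.
move=> sI; apply/subspace_continuousP => s; rewrite /= in_itv /= => sab A nA.
have C : {for s, continuous (fun s : R => s *: v + p)}.
  by apply: cvgD; [exact: scalel_continuous | exact: cvg_cst].
have N : nbhs s (fun r : R => 0 <= (r *: v + p).2 <= 1 -> A (g i (r *: v + p))).
  exact: C _ (gcont (sI s sab) nA).
change (nbhs s (fun r : R => `[a, b]%classic r -> A (g i (r *: v + p)))).
by apply: filterS N => r H; rewrite /= in_itv /= => rab; apply: H; exact: sI.
Qed.

Lemma bend_affine t x : (forall s i, 0 < 2^-1 + s < 1 ->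
    'D_((t, 1) : R * R) ('D_((t, 1) : R * R) (g i)) (s *: ((t, 1) : R * R) + (x, 2^-1)) = 0) ->
  exists c : 'I_3 -> R, dot c c = 1 + t ^+ 2 /\
    forall i y, 0 <= y <= 1 -> g i (x + t * (y - 2^-1), y) = g i (x - t / 2, 0) + c i * y.
Proof.
move=> D0; pose v : R * R := (t, 1); pose p : R * R := (x, 2^-1).
have ab : - 2^-1 < 2^-1 :> R by lra.
have lE s : s *: v + p = (x + t * s, s + 2^-1).
  by apply: pair_ext; rewrite /= /GRing.scale /=; ring.
have Us s : - 2^-1 < s < 2^-1 -> U (s *: v + p) by rewrite lE /U /=; lra.
have D0' i s : - 2^-1 < s < 2^-1 -> 'D_v ('D_v (g i)) (s *: v + p) = 0.
  by move=> sI; apply: D0; lra.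
have C i : {within `[- 2^-1, 2^-1], continuous (fun s : R => g i (s *: v + p))}.
  by apply: continuous_line => s sI; rewrite lE /=; lra.
have H i := affine_along open_strip (sg i) ab Us (D0' i) (C i).
pose c i := 'D_v (g i) p.
have U0 : U p by rewrite /U /=; lra.
have cE i s : - 2^-1 <= s <= 2^-1 -> g i (s *: v + p) = g i (- 2^-1 *: v + p) + c i * (s - - 2^-1).
  have [k [Dk gk]] := H i; suff -> : c i = k by exact: gk.
  by rewrite -(Dk 0) ?scale0r ?add0r//; lra.
exists c; split.
  have d i : c i = t * 'D_e1 (g i) p + 1 * 'D_e2 (g i) p := dirE v (sg i) U0.
  have alg (a b : 'I_3 -> R) : dot a a = 1 -> dot a b = 0 -> dot b b = 1 ->
      (forall i, c i = t * a i + 1 * b i) -> dot c c = 1 + t ^+ 2.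
    move=> aa ab0 bb E; rewrite dotE !E.
    transitivity (t ^+ 2 * dot a a + 2 * t * dot a b + dot b b); first by rewrite !dotE; ring.
    by rewrite aa ab0 bb; ring.
  exact: alg (D11 U0) (D12 U0) (D22 U0) d.
move=> i y yI; have := cE i (y - 2^-1); rewrite !lE opprK !subrK addNr mulrN => E.
by rewrite E //; lra.
Qed.

(** The mean value theorem is applied to the projection of [g] onto the chord [d]; its derivative is
    at most the length of [d] by Cauchy-Schwarz. *)
Lemma horizontal_lipschitz_interior y x x' : 0 < y < 1 ->
  dot (fun i => g i (x', y) - g i (x, y)) (fun i => g i (x', y) - g i (x, y)) <= (x' - x) ^+ 2.
Proof.
move=> yI; set d := fun i => _.
have Ux z : U (z, y) by [].
(* The coefficients 1 and the zero term fit the shape of [is_derive_lin]; the function is the scalar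
   product of [d] with [g]. *)
pose f q := 1 * (1 * (d 0 * g 0 q + d 1 * g 1 q) + d 2 * g 2 q) + 0 * g 0 q.
have df q : U q -> is_derive q e1 f (dot d ((D e1 g) ^@ q)).
  move=> Uq; have D i := smooth_is_derive e1 open_strip (sg i) Uq.
  have := is_derive_lin 1 0 (is_derive_lin 1 (d 2) (is_derive_lin (d 0) (d 1) (D 0) (D 1)) (D 2)) (D 0).
  by move=> /is_derive_eq; apply; rewrite dotE; ring.
have [s _] : exists2 s : R, `|s| <= `|x' - x| &
    f ((x' - x) *: e1 + (x, y)) - f (x, y) = (x' - x) * 'D_e1 f (s *: e1 + (x, y)).
  apply: MVT_line => s _; have [] := df (s *: e1 + (x, y)) => //.
  exact: strip_shift.
have Us : U (s *: e1 + (x, y)) by exact: strip_shift.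
have [_ ->] := df _ Us.
have -> : (x' - x) *: e1 + (x, y) = (x', y) :> R * R.
  by apply: pair_ext; rewrite /= /GRing.scale /=; ring.
have -> : f (x', y) - f (x, y) = dot d d by rewrite dotE /f /d; ring.
have := D11 Us; set e := fun i => _ => ee E.
have cs : dot d e ^+ 2 <= dot d d.
  rewrite -[leRHS]mulr1 -ee -subr_ge0.
  have -> : dot d d * dot e e - dot d e ^+ 2 = (d 0 * e 1 - d 1 * e 0) ^+ 2 +
      (d 1 * e 2 - d 2 * e 1) ^+ 2 + (d 2 * e 0 - d 0 * e 2) ^+ 2 by rewrite !dotE; ring.
  by rewrite !addr_ge0 ?sqr_ge0.
have [->|d0] := eqVneq (dot d d) 0; first exact: sqr_ge0.
have dp : 0 < dot d d by rewrite lt_neqAle eq_sym d0 dotE -!expr2 !addr_ge0 ?sqr_ge0.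
rewrite -(ler_pM2r dp) -expr2 E exprMn ler_wpM2l ?sqr_ge0//.
by rewrite -E.
Qed.

(** The boundary lines [y = 0] and [y = 1], needed for the perimeter estimate, are reached by
    continuity. *)
Lemma horizontal_lipschitz y x x' : 0 <= y <= 1 ->
  dot (fun i => g i (x', y) - g i (x, y)) (fun i => g i (x', y) - g i (x, y)) <= (x' - x) ^+ 2.
Proof.
apply: (@le_closure_itv R (fun y => dot (fun i => g i (x', y) - g i (x, y))
  (fun i => g i (x', y) - g i (x, y)))); last by move=> z; exact: horizontal_lipschitz_interior.
have C i z : {within `[0, 1], continuous (fun y : R => g i (z, y))}.
  have -> : (fun y : R => g i (z, y)) = (fun s : R => g i (s *: e2 + (z, 0))).
    by apply/funext => s; congr g; apply: pair_ext; rewrite /= /GRing.scale /=; ring.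
  by apply: continuous_line => s; rewrite /= /GRing.scale /= mulr1 addr0.
have Cd i : {within `[0, 1], continuous (fun y : R => g i (x', y) - g i (x, y))}.
  by move=> s; apply: cvgB; exact: C.
have -> : (fun y => dot (fun i => g i (x', y) - g i (x, y)) (fun i => g i (x', y) - g i (x, y))) =
   (fun y => (g 0 (x', y) - g 0 (x, y)) * (g 0 (x', y) - g 0 (x, y)) +
             (g 1 (x', y) - g 1 (x, y)) * (g 1 (x', y) - g 1 (x, y)) +
             (g 2 (x', y) - g 2 (x, y)) * (g 2 (x', y) - g 2 (x, y))).
  by apply/funext => s; rewrite dotE.
by move=> s; apply: cvgD; [apply: cvgD|]; apply: cvgM; exact: Cd.
Qed.

End StripLemmas.

(** * A Borsuk-Ulam argument *)

Section Tucker.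
Local Open Scope nat_scope.
Implicit Types (l : nat -> nat -> bool * bool) (a b c d : bool * bool).

(* Tucker's labels 1, 2, -1, -2: the first component tells 1 from 2, the second
   one is the sign. *)
Definition opposite a : bool * bool := (a.1, ~~ a.2).
(** An edge joining the labels 1 and 2, both positive. *)
Definition crossing a b := [&& a.2, b.2 & a.1 != b.1].
Definition compatible a b := b != opposite a.

(** If both 1 and 2 occur, compatibility excludes negative labels, and a cyclic word in two letters
    changes letter an even number of times. The diagonals of the cell must be compatible too. *)
Lemma cell_parity a b c d : compatible a b -> compatible a c -> compatible a d ->
  compatible b c -> compatible b d -> compatible c d ->
  crossing a b (+) crossing c d = crossing a c (+) crossing b d.
Proof. by move: a b c d => [[] []] [[] []] [[] []] [[] []]. Qed.

(** The labels fall into the classes [{1, -2}] and [{-1, 2}]; a compatible edge changes class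
    exactly when it joins 1 to 2 or -1 to -2. *)
Lemma crossing_opposite a b : compatible a b ->
  crossing a b (+) crossing (opposite a) (opposite b) = (a.1 == a.2) (+) (b.1 == b.2).
Proof. by move: a b => [[] []] [[] []]. Qed.

Definition good_cell l i j := forall i1 j1 i2 j2, i <= i1 <= i.+1 -> j <= j1 <= j.+1 ->
  i <= i2 <= i.+1 -> j <= j2 <= j.+1 -> compatible (l i1 j1) (l i2 j2).

Definition crossings n (s : nat -> bool * bool) := \big[addb/false]_(i < n) crossing (s i) (s i.+1).

Lemma crossingsS n s : crossings n.+1 s = crossings n s (+) crossing (s n) (s n.+1).
Proof. by rewrite /crossings big_ord_recr. Qed.

Lemma row_parity l n j : (forall i, i < n -> good_cell l i j) ->
  crossings n (l ^~ j) (+) crossings n (l ^~ j.+1) =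
  crossing (l 0 j) (l 0 j.+1) (+) crossing (l n j) (l n j.+1).
Proof.
elim: n => [|n IH] H; first by rewrite /crossings !big_ord0 !addbb.
have C : crossing (l n j) (l n.+1 j) (+) crossing (l n j.+1) (l n.+1 j.+1) =
         crossing (l n j) (l n j.+1) (+) crossing (l n.+1 j) (l n.+1 j.+1).
  by have G := H n (ltnSn n); apply: cell_parity; apply: G; rewrite ?leqnn ?leqnSn.
rewrite !crossingsS addbACA IH ?C; last by move=> i /ltnW; exact: H.
by rewrite addbA -(addbA _ (crossing (l n j) _) (crossing (l n j) _)) addbb addbF.
Qed.

(** Summing over all cells, interior edges count twice: the boundary of the grid has an even number
    of crossings. *)
Lemma grid_parity l n m : (forall i j, i < n -> j < m -> good_cell l i j) ->
  crossings n (l ^~ 0) (+) crossings n (l ^~ m) = crossings m (l 0) (+) crossings m (l n).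
Proof.
elim: m => [|m IH] H; first by rewrite !addbb /crossings !big_ord0.
have R : crossings n (l ^~ m) (+) crossings n (l ^~ m.+1) =
   crossing (l 0 m) (l 0 m.+1) (+) crossing (l n m) (l n m.+1).
  by apply: row_parity => i ilt; exact: H.
rewrite !crossingsS addbACA -R -IH; last by move=> i j ? ?; apply: H => //; exact: ltnW.
by move: (crossings n (l ^~ 0)) (crossings n (l ^~ m)) (crossings n (l ^~ m.+1)) => [] [] [].
Qed.

Lemma crossings_antipodal n (s : nat -> bool * bool) : (forall i, i < n -> compatible (s i) (s i.+1)) ->
  crossings n s (+) crossings n (fun i => opposite (s i)) =
  ((s 0).1 == (s 0).2) (+) ((s n).1 == (s n).2).
Proof.
elim: n => [|n IH] H; first by rewrite /crossings !big_ord0 !addbb.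
rewrite !crossingsS addbACA IH; last by move=> i /ltnW; exact: H.
rewrite crossing_opposite ?H//.
by move: (_ == _) (_ == _) (_ == _) => [] [] [].
Qed.

Lemma crossings_const n (s : nat -> bool * bool) a : (forall i, i <= n -> s i = a) -> crossings n s = false.
Proof.
elim: n => [|n IH] H; first by rewrite /crossings big_ord0.
rewrite crossingsS IH; last by move=> i /leqW; exact: H.
by rewrite !H// /crossing eqxx !andbF.
Qed.

(** Two sides are constant and have no crossings, so the other two have an even number together.
    They carry opposite labels and run from 1 to -1, a change of class, so [crossings_antipodal]
    makes that number odd. *)
Lemma tucker_grid l n : (forall i j, i < n -> j < n -> good_cell l i j) ->
  (forall i, i <= n -> l i 0 = (true, true)) -> (forall j, j <= n -> l n j = (true, true)) ->
  (forall i, i <= n -> l i n = opposite (l 0 i)) -> False.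
Proof.
move=> H l0 ln lo; have := grid_parity H.
rewrite (crossings_const l0) (crossings_const ln) addbF addFb.
have E : crossings n (l ^~ n) = crossings n (fun i => opposite (l 0 i)).
  by apply: eq_bigr => i _; rewrite !lo// ltnW.
have n0 : 0 < n.
  by rewrite lt0n; apply/eqP => n0; have := lo 0 (leq0n n); rewrite n0 l0.
have C i : i < n -> compatible (l 0 i) (l 0 i.+1).
  by move=> ilt; apply: (H 0 i); rewrite ?leqnn ?leqnSn.
have := crossings_antipodal C; rewrite -E => + EV.
by rewrite EV addbb lo// !l0.
Qed.

End Tucker.

(** A sign change between [b] and [c] forces [|a| < m / 3], then [|y| <= |b| < 2 m / 3] and
    [|x| < m], so [m] is neither [|a|] nor [|x|]. *)
Lemma opposite_near {R : realDomainType} (m a b c x y : R) :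
  0 < m -> m = `|a| \/ m = `|x| -> (b <= 0 <= c) \/ (c <= 0 <= b) -> `|y| <= `|b| ->
  `|a - b| * 3 < m -> `|a - c| * 3 < m -> `|x - y| * 3 < m -> False.
Proof.
move=> m0 max sg yb ab ac xy.
have a3 : `|a| * 3 < m.
  have : (`|a| <= `|a - b|) \/ (`|a| <= `|a - c|).
    by case: sg; case: (ger0P a) => a0 s; [left|right|right|left];
      case: (ger0P (a - b)); case: (ger0P (a - c)); lra.
  by case; lra.
have bb : `|b| <= `|a| + `|a - b|.
  by rewrite -{1}(subKr a b); exact: ler_normB.
have xx : `|x| <= `|y| + `|x - y|.
  by rewrite -{1}(subrK y x) addrC; exact: ler_normD.
by case: max; lra.
Qed.

(** * Common zeros of two symmetric antiperiodic functions *)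

Section CommonZero.
Context {R : realType} (f h : R -> R -> R) (lam : R).
Hypothesis lam0 : 0 < lam.
Hypothesis fcont : forall p : R * R, {for p, continuous (fun p => f p.1 p.2)}.
Hypothesis hcont : forall p : R * R, {for p, continuous (fun p => h p.1 p.2)}.
Hypotheses (fsym : forall x y, f x y = f y x) (hsym : forall x y, h x y = h y x).
Hypotheses (fanti : forall x y, f x (y + lam) = - f x y) (hanti : forall x y, h x (y + lam) = - h x y).
Hypotheses (fdiag : forall x, 0 < f x x) (hdiag : forall x, h x x = 0).
Implicit Types (p q : R * R).

(** Folds the square onto the triangle above the diagonal by collapsing the lower half to the
    diagonal, which allows a square grid in Tucker's lemma. *)
Let tri p : R * R := (Num.min p.1 p.2, p.2).
Let F p := f (tri p).1 (tri p).2.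
Let H p := h (tri p).1 (tri p).2.

(** The dominant one of [F] and [H], with its sign. *)
Let label p : bool * bool :=
  if `|H p| <= `|F p| then (true, 0 < F p) else (false, 0 < H p).

Let min_near (a b c e d : R) : `|c - a| < d -> `|e - b| < d -> `|Num.min c e - Num.min a b| < d.
Proof.
by rewrite /Num.min; case: (ltP c e); case: (ltP a b); rewrite !ltr_norml => *; apply/andP; split; lra.
Qed.

Let near_tri (k : R -> R -> R) p (e : R) : {for tri p, continuous (fun p => k p.1 p.2)} -> 0 < e ->
  exists2 d : R, 0 < d & forall q, `|q.1 - p.1| < d -> `|q.2 - p.2| < d ->
    `|k (tri p).1 (tri p).2 - k (tri q).1 (tri q).2| < e.
Proof.
move=> /cvgrPdist_lt /(_ e) kc /kc /nbhs_box[d d0 dP]; exists d => // q q1 q2.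
by apply: (dP (tri q)) => //=; exact: min_near.
Qed.

Let near_compatible p : F p != 0 \/ H p != 0 ->
  exists2 d : R, 0 < d & forall q r, `|q.1 - p.1| < d -> `|q.2 - p.2| < d ->
    `|r.1 - p.1| < d -> `|r.2 - p.2| < d -> compatible (label q) (label r).
Proof.
move=> FH.
pose M := Num.max `|F p| `|H p|.
have M0 : 0 < M by rewrite lt_max !normr_gt0; exact/orP.
have M3 : 0 < M / 3 by rewrite divr_gt0.
have third (a : R) : a < M / 3 -> a * 3 < M by lra.
have [d1 d10 dF] := near_tri (@fcont (tri p)) M3.
have [d2 d20 dH] := near_tri (@hcont (tri p)) M3.
exists (Num.min d1 d2); first by rewrite lt_min d10.
move=> q r; rewrite !lt_min => /andP[q11 q12] /andP[q21 q22] /andP[r11 r12] /andP[r21 r22].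
have Fq := third _ (dF q q11 q21); have Fr := third _ (dF r r11 r21).
have Hq := third _ (dH q q12 q22); have Hr := third _ (dH r r12 r22).
rewrite -/(F p) -/(F q) -/(F r) in Fq Fr; rewrite -/(H p) -/(H q) -/(H r) in Hq Hr.
have : M = `|F p| \/ M = `|H p| by rewrite /M; case: leP; [right|left].
have opp (b c : R) : (0 < c) = ~~ (0 < b) -> (b <= 0 <= c) \/ (c <= 0 <= b).
  by case: (ltP 0 c); case: (ltP 0 b) => //= ? ? _; [left|right]; lra.
move=> MM; rewrite /compatible; apply/eqP; rewrite /opposite /label.
case: (lerP `|H q| `|F q|) => Lq; case: (lerP `|H r| `|F r|) => Lr [] // /opp sg.
- exact: (opposite_near M0 MM sg Lq Fq Fr Hq).
- exact: (opposite_near M0 (proj1 (or_comm _ _) MM) sg (ltW Lq) Hq Hr Fq).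
Qed.

(** On and below the diagonal the label is 1, as [f > 0 = h] there. Antiperiodicity and symmetry
    give opposite labels at [(x, lam)] and [(0, x)]. Without a common zero a fine grid would
    contradict [tucker_grid]. *)
Lemma symmetric_common_zero : exists x y, [/\ 0 <= x, x <= y, y <= lam, f x y = 0 & h x y = 0].
Proof.
apply: contrapT => nz.
have triE x y : x <= y -> tri (x, y) = (x, y) by move=> xy; rewrite /tri /= min_l.
have FH p : 0 <= p.1 <= lam -> 0 <= p.2 <= lam -> F p != 0 \/ H p != 0.
  move=> p1 p2; have [F0|] := eqVneq (F p) 0; last by left.
  have [H0|] := eqVneq (H p) 0; last by right.
  exfalso; apply: nz; exists (tri p).1, (tri p).2; split => //; rewrite /tri /=.
  - by rewrite le_min; case/andP: p1 => ->; case/andP: p2 => ->.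
  - by rewrite ge_min lexx orbT.
  - by case/andP: p2.
pose K : set (R * R) := `[0, lam] `*` `[0, lam].
have cK : compact K by apply: compact_setX; exact: segment_compact.
pose P (n : nat) p := forall q r, `|q.1 - p.1| <= lam / n%:R -> `|q.2 - p.2| <= lam / n%:R ->
    `|r.1 - p.1| <= lam / n%:R -> `|r.2 - p.2| <= lam / n%:R -> compatible (label q) (label r).
(* Compactness turns the pointwise radii of [near_compatible] into a single mesh width [lam / n]. *)
have : \forall n \near \oo, K `<=` P n.
  apply: (compact_near_coveringP K).1 => // p [/=]; rewrite !in_itv /= => p1 p2.
  have [d d0 dP] := near_compatible (FH p p1 p2).
  have d2 : 0 < d / 2 by rewrite divr_gt0.
  exists ([set q : R * R | `|q.1 - p.1| < d / 2 /\ `|q.2 - p.2| < d / 2], [set n | lam / (d / 2) < n%:R]).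
    split; last exact: nbhs_infty_gtr.
    apply/nbhs_ballP; exists (d / 2) => // q; rewrite /ball /= /prod_ball -!ball_normE /= => -[q1 q2].
    by split; rewrite distrC.
  move=> [q n] /= [[q1 q2] nd] r s.
  have n0 : 0 < n%:R :> R by apply: lt_trans nd; rewrite divr_gt0.
  have ln : lam / n%:R < d / 2 by rewrite ltr_pdivrMr// mulrC -ltr_pdivrMr.
  have tri3 (a b c : R) : `|b - a| < d / 2 -> `|c - b| <= lam / n%:R -> `|c - a| < d.
    by move: ln; move: (lam / n%:R) => t tl; rewrite !ltr_norml ler_norml; lra.
  by move=> r1 r2 s1 s2; apply: dP; [exact: tri3 r1|exact: tri3 r2|exact: tri3 s1|exact: tri3 s2].
move=> near_ok.
have [N /= _ HN] : \forall n \near \oo, K `<=` P n /\ (0 < n)%N.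
  by apply: filterI => //; exact: nbhs_infty_gt.
have [KP N0] := HN N (leqnn N).
have N0' : 0 < N%:R :> R by rewrite ltr0n.
pose x (i : nat) : R := lam * i%:R / N%:R.
have x0 : x 0%N = 0 by rewrite /x mulr0 mul0r.
have xN : x N = lam by rewrite /x mulfK ?gt_eqF.
have xle i j : (i <= j)%N -> x i <= x j.
  by move=> ij; rewrite /x ler_pM2r ?invr_gt0// ler_pM2l// ler_nat.
have xS i : x i.+1 = x i + lam / N%:R.
  by rewrite /x -natr1 mulrDr mulr1 mulrDl.
have xI i : (i <= N)%N -> 0 <= x i <= lam.
  by move=> iN; rewrite -{1}x0 -xN !xle.
have xnear i i1 : (i <= i1 <= i.+1)%N -> `|x i1 - x i| <= lam / N%:R.
  move=> /andP[le1 le2]; have := xle _ _ le1; have := xle _ _ le2; rewrite xS => ? ?.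
  by rewrite ger0_norm; lra.
have labF p q : 0 <= p.1 <= lam -> 0 <= p.2 <= lam -> F q = - F p -> H q = - H p ->
    label q = opposite (label p).
  move=> p1 p2 Fq Hq; rewrite /label Fq Hq !normrN; have := FH p p1 p2.
  have sgn (a : R) : a != 0 -> (0 < - a) = ~~ (0 < a) by rewrite oppr_gt0 -leNgt le_eqVlt => /negPf ->.
  case: (lerP `|H p| `|F p|) => L FH0; rewrite /opposite /= sgn//.
    by case: FH0 => // H0; rewrite -normr_gt0; apply: lt_le_trans L; rewrite normr_gt0.
  by rewrite -normr_gt0; apply: le_lt_trans L.
have diag z p : tri p = (z, z) -> label p = (true, true).
  by move=> pz; rewrite /label /F /H pz /= hdiag normr0 normr_ge0 fdiag.
apply: (@tucker_grid (fun i j => label (x i, x j)) N).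
- move=> i j iN jN i1 j1 i2 j2 I1 J1 I2 J2; apply: (KP (x i, x j)); rewrite /= ?xnear//.
  by split; rewrite /= in_itv /= xI// ltnW.
- move=> i iN; apply: (diag 0); rewrite /tri /= x0 min_r//.
  by case/andP: (xI i iN).
- move=> j jN; apply: (diag (x j)); rewrite /tri /= min_r// xle//.
- move=> i iN; rewrite x0 xN; have /andP[xi0 xil] := xI i iN.
  apply: labF; rewrite /= ?lexx ?(ltW lam0)//; first by rewrite xi0.
  + by rewrite /F !triE//= -[X in f _ X]add0r fanti fsym.
  + by rewrite /H !triE//= -[X in h _ X]add0r hanti hsym.
Qed.

End CommonZero.

(** * The T-pattern *)

Section TPattern.
Context {R : realType}.

(** A triangle with base of squared length [A], squared height [h] and sides at most [d] and [d'];
    the foot of the height is [al] base lengths from the midpoint. Only the isosceles triangle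
    attains the least perimeter. *)
Lemma apex_bound (A h al d d' : R) : 0 <= A -> 0 <= h -> 0 <= d -> 0 <= d' ->
  (al + 2^-1) ^+ 2 * A + h <= d ^+ 2 -> (al - 2^-1) ^+ 2 * A + h <= d' ^+ 2 ->
  A + 4 * h <= (d + d') ^+ 2 /\ (A * h * al != 0 -> A + 4 * h < (d + d') ^+ 2).
Proof.
move=> A0 h0 d0 d'0 H H'.
(* The product of the squared sides is [c ^ 2 + 4 al ^ 2 A h], and their sum is [A + 4 h - 2 c]. *)
pose c := (2^-1 + al) * (2^-1 - al) * A + h.
have dd : 0 <= d * d' by rewrite mulr_ge0.
have P0 : 0 <= (al + 2^-1) ^+ 2 * A + h by rewrite addr_ge0// mulr_ge0// sqr_ge0.
have P0' : 0 <= (al - 2^-1) ^+ 2 * A + h by rewrite addr_ge0// mulr_ge0// sqr_ge0.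
have le : c ^+ 2 + 4 * (al ^+ 2 * (A * h)) <= (d * d') ^+ 2.
  rewrite exprMn; apply: le_trans (ler_pM P0 P0' H H').
  have -> : ((al + 2^-1) ^+ 2 * A + h) * ((al - 2^-1) ^+ 2 * A + h) = c ^+ 2 + 4 * (al ^+ 2 * (A * h)).
    by rewrite /c; field.
  by [].
have sum : A + 4 * h + 2 * (d * d' - c) <= (d + d') ^+ 2.
  have -> : (d + d') ^+ 2 = d ^+ 2 + d' ^+ 2 + 2 * (d * d') by ring.
  have -> : A + 4 * h + 2 * (d * d' - c) = ((al + 2^-1) ^+ 2 * A + h) + ((al - 2^-1) ^+ 2 * A + h) + 2 * (d * d').
    by rewrite /c; field.
  by lra.
have Ah : 0 <= al ^+ 2 * (A * h) by rewrite mulr_ge0 ?sqr_ge0// mulr_ge0.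
split.
  suff : c <= d * d' by lra.
  rewrite leNgt; apply/negP => lt; have : (d * d') ^+ 2 < c ^+ 2 by rewrite ltr_pXn2r// nnegrE//; lra.
  by lra.
rewrite !mulf_eq0 !negb_or -andbA => /and3P[A1 h1 al1].
have Ah' : 0 < al ^+ 2 * (A * h).
  have Ap : 0 < A by rewrite lt_neqAle eq_sym A1.
  have hp : 0 < h by rewrite lt_neqAle eq_sym h1.
  by rewrite mulr_gt0 ?exprn_even_gt0// mulr_gt0.
suff : c < d * d' by lra.
rewrite ltNge; apply/negP => cl.
have : (d * d') ^+ 2 <= c ^+ 2 by rewrite ler_pXn2r// nnegrE//; lra.
by lra.
Qed.

(** The base is one bend, the apexes are the ends of the other, at signed heights [be + 2^-1] and
    [be - 2^-1] times the root of [B]; [2^-1 <= |be|] puts both on one side. *)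
Lemma T_pattern_bound (lam t B al be d1 d2 d3 d4 : R) : 1 <= B ->
  0 <= d1 -> 0 <= d2 -> 0 <= d3 -> 0 <= d4 ->
  (al + 2^-1) ^+ 2 * (1 + t ^+ 2) + (be + 2^-1) ^+ 2 * B <= d1 ^+ 2 ->
  (al - 2^-1) ^+ 2 * (1 + t ^+ 2) + (be + 2^-1) ^+ 2 * B <= d2 ^+ 2 ->
  (al - 2^-1) ^+ 2 * (1 + t ^+ 2) + (be - 2^-1) ^+ 2 * B <= d3 ^+ 2 ->
  (al + 2^-1) ^+ 2 * (1 + t ^+ 2) + (be - 2^-1) ^+ 2 * B <= d4 ^+ 2 ->
  d1 + d2 = lam + t -> d3 + d4 = lam - t -> 2^-1 <= `|be| ->
  (`|be| = 2^-1 -> 2^-1 <= `|al|) -> 3 < lam ^+ 2.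
Proof.
move=> B1.
(* Negating [be] exchanges the two boundary arcs, hence [t] with [- t]. *)
wlog be0 : t be d1 d2 d3 d4 / 0 <= be.
  move=> W p1 p2 p3 p4 H1 H2 H3 H4 E1 E2 bh nc.
  have [b0|b0] := leP 0 be; first exact: (W t be d1 d2 d3 d4).
  have b0' : 0 <= - be by lra.
  have n1 : (- be + 2^-1) ^+ 2 = (be - 2^-1) ^+ 2 by ring.
  have n2 : (- be - 2^-1) ^+ 2 = (be + 2^-1) ^+ 2 by ring.
  have := W (- t) (- be) d4 d3 d2 d1 b0' p4 p3 p2 p1.
  rewrite sqrrN normrN n1 n2 opprK (addrC d4) E2 (addrC d2) E1.
  by move=> /(_ H4 H3 H2 H1 erefl erefl bh nc).
move=> p1 p2 p3 p4 H1 H2 H3 H4 E1 E2; rewrite ger0_norm// => bh nc.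
have A1 : 0 <= 1 + t ^+ 2 by rewrite addr_ge0// sqr_ge0.
have Bp : 0 <= (be + 2^-1) ^+ 2 * B by rewrite mulr_ge0 ?sqr_ge0//; lra.
have Bm : 0 <= (be - 2^-1) ^+ 2 * B by rewrite mulr_ge0 ?sqr_ge0//; lra.
have [L1 S1] := apex_bound A1 Bp p1 p2 H1 H2.
have [L2 _] := apex_bound A1 Bm p4 p3 H4 H3.
rewrite E1 in L1 S1; rewrite (addrC d4) E2 in L2.
have h1 : 1 <= (be + 2^-1) ^+ 2 * B.
  rewrite -[leLHS]mulr1; apply: ler_pM => //; rewrite -[leLHS](expr1n _ 2) ler_pXn2r// ?nnegrE; lra.
have X1 : (lam + t) ^+ 2 = lam ^+ 2 + 2 * (lam * t) + t ^+ 2 by ring.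
have X2 : (lam - t) ^+ 2 = lam ^+ 2 - 2 * (lam * t) + t ^+ 2 by ring.
rewrite X1 in L1 S1; rewrite X2 in L2.
(* If an apex lies on the base line, the other triangle is not isosceles and its bound is strict;
   otherwise the nearer apex has positive height. *)
have [bE|bN] := eqVneq be (2^-1).
  have al0 : al != 0 by apply: contraTneq (nc bE) => ->; rewrite normr0; lra.
  have : (1 + t ^+ 2) * ((be + 2^-1) ^+ 2 * B) * al != 0.
    have n1 : 1 + t ^+ 2 != 0 by rewrite gt_eqF//; have := sqr_ge0 t; lra.
    have n2 : (be + 2^-1) ^+ 2 * B != 0 by rewrite gt_eqF//; move: h1; lra.
    by apply: mulf_neq0 al0; exact: mulf_neq0.
  by move=> /S1; lra.
have : 0 < (be - 2^-1) ^+ 2 * B.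
  by apply: mulr_gt0; [rewrite exprn_even_gt0 //= subr_eq0 | lra].
by lra.
Qed.

End TPattern.

Lemma sqr_le_dot {R : realType} (a : 'I_3 -> R) i : a i ^+ 2 <= dot a a.
Proof.
rewrite dotE -!expr2.
have := sqr_ge0 (a 0); have := sqr_ge0 (a 1); have := sqr_ge0 (a 2).
by move: i; apply: forall_I3; lra.
Qed.

Lemma lipschitz_continuous {R : realType} (k : R -> R) (L : R) x :
  (forall a b, `|k a - k b| <= L * `|a - b|) -> {for x, continuous k}.
Proof.
move=> kL; apply/cvgrPdist_le => /= e e0.
have L1 : 0 < `|L| + 1 by rewrite ltr_pwDr.
near=> z; apply: le_trans (kL x z) _.
have : `|x - z| < e / (`|L| + 1).
  by near: z; apply/nbhs_normP; exists (e / (`|L| + 1)); rewrite //= divr_gt0.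
rewrite ltr_pdivlMr// mulrDr mulr1 => H.
have : L * `|x - z| <= `|L| * `|x - z| by rewrite ler_wpM2r// ler_norm.
by have := normr_ge0 (x - z); lra.
Unshelve. all: by end_near. Qed.

(** The Gram determinant of [a], [u], [w] is the square of their triple product. *)
Lemma orthogonal_zero {R : realType} (a u w : 'I_3 -> R) :
  0 < dot u u -> 0 < dot w w -> dot u w = 0 ->
  dot a u = 0 -> dot a w = 0 -> dot a (cross u w) = 0 -> forall i, a i = 0.
Proof.
move=> uu ww uw au aw an i.
have : dot a a * (dot u u * dot w w) = 0.
  transitivity (dot a (cross u w) ^+ 2 + dot a a * dot u w ^+ 2 + dot a w ^+ 2 * dot u u
    - 2 * dot a w * dot a u * dot u w + dot a u ^+ 2 * dot w w).
    by rewrite !dotE !crossE; ring.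
  by rewrite uw au aw an; ring.
move/eqP; rewrite mulf_eq0 [_ * _ == 0]gt_eqF ?mulr_gt0// orbF => /eqP aa.
by apply/eqP; rewrite -sqrf_eq0 eq_le sqr_ge0 andbT -aa sqr_le_dot.
Qed.

(** * From the family of bends to the inequality *)

Section BendFamily.
Context {R : realType} (lam : R) (g : 'I_3 -> R * R -> R) (t : R -> R).
Hypothesis lam0 : 0 < lam.
Hypothesis tlip : forall x y, `|t x - t y| <= 2 * `|x - y|.
Hypothesis tanti : forall x, t (x + lam) = - t x.
Hypothesis bend : forall x, exists c : 'I_3 -> R, dot c c = 1 + t x ^+ 2 /\
  forall i (y : R), 0 <= y <= 1 -> g i (x + t x * (y - 2^-1), y) = g i (x - t x / 2, 0) + c i * y.
Hypothesis hlip : forall y x x' : R, 0 <= y <= 1 ->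
  dot (fun i => g i (x', y) - g i (x, y)) (fun i => g i (x', y) - g i (x, y)) <= (x' - x) ^+ 2.
Hypothesis deck : forall i (x y : R), 0 <= y <= 1 -> g i (x + lam, y) = g i (x, 1 - y).
Hypothesis emb : forall p q : R * R, 0 <= p.2 <= 1 -> 0 <= q.2 <= 1 ->
  (forall i, g i p = g i q) -> moeb_rel lam p q.

(** [P x] and [Q x] are the images of the ends of the bend on the two boundary lines; translation by
    [lam] exchanges them. *)
Let P x : 'I_3 -> R := fun i => g i (x - t x / 2, 0).
Let Q x : 'I_3 -> R := fun i => g i (x + t x / 2, 1).
Let u x : 'I_3 -> R := fun i => Q x i - P x i.
Let m x : 'I_3 -> R := fun i => P x i + u x i / 2.

Let I0 : 0 <= (0 : R) <= 1. Proof. by rewrite lexx ler01. Qed.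
Let I1 : 0 <= (1 : R) <= 1. Proof. by rewrite lexx ler01. Qed.

Let bendE x : dot (u x) (u x) = 1 + t x ^+ 2 /\
  forall i y, 0 <= y <= 1 -> g i (x + t x * (y - 2^-1), y) = P x i + u x i * y.
Proof.
have [c [cc cE]] := bend x.
have uc i : u x i = c i.
  have := cE i 1 I1; rewrite (_ : 1 - 2^-1 = 2^-1); last by lra.
  by rewrite /u /P /Q => ->; rewrite mulr1 addrC addKr.
split; first by rewrite -cc !dotE !uc.
by move=> i y yI; rewrite uc; exact: cE.
Qed.

Let PD x i : P (x + lam) i = Q x i.
Proof. by rewrite /P /Q tanti addrAC deck// subr0; congr (g i (_, _)); ring. Qed.

Let QD x i : Q (x + lam) i = P x i.
Proof. by rewrite /P /Q tanti addrAC deck// subrr; congr (g i (_, _)); ring. Qed.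

Let uD x i : u (x + lam) i = - u x i.
Proof. by rewrite /u PD QD opprB. Qed.

Let mD x i : m (x + lam) i = m x i.
Proof. by rewrite /m uD PD /u; field. Qed.

(** Constant 2 is exactly what keeps the ends of the bends in order along the boundary, since an end
    moves by half the change of [t]. *)
Let monoP x y : x <= y -> 0 <= (y - t y / 2) - (x - t x / 2).
Proof.
move=> xy; have := tlip y x; rewrite [`|y - x|]ger0_norm ?subr_ge0// ler_norml => /andP[_]; lra.
Qed.

Let monoQ x y : x <= y -> 0 <= (y + t y / 2) - (x + t x / 2).
Proof.
move=> xy; have := tlip y x; rewrite [`|y - x|]ger0_norm ?subr_ge0// ler_norml => /andP[+ _]; lra.
Qed.

Let coord_lip i y x x' : 0 <= y <= 1 -> `|g i (x, y) - g i (x', y)| <= `|x - x'|.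
Proof.
move=> yI; rewrite -ler_sqr ?nnegrE// !real_normK ?num_real//.
exact: le_trans (sqr_le_dot (fun i => g i (x, y) - g i (x', y)) i) (hlip x' x yI).
Qed.

Let lipPQ i x y : `|P x i - P y i| <= 2 * `|x - y| /\ `|Q x i - Q y i| <= 2 * `|x - y|.
Proof.
have h2 : `|(t x - t y) / 2| <= `|x - y|.
  by rewrite normrM normfV [`|2|]ger0_norm// ler_pdivrMr// mulrC.
split.
  apply: le_trans (coord_lip i _ _ I0) _.
  rewrite (_ : x - t x / 2 - (y - t y / 2) = (x - y) - (t x - t y) / 2); last by field.
  by apply: (le_trans (ler_normB _ _)); lra.
apply: le_trans (coord_lip i _ _ I1) _.
rewrite (_ : x + t x / 2 - (y + t y / 2) = (x - y) + (t x - t y) / 2); last by field.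
by apply: (le_trans (ler_normD _ _)); lra.
Qed.

Let contPQ i x : {for x, continuous (fun x => P x i)} /\ {for x, continuous (fun x => Q x i)}.
Proof.
by split; apply: (@lipschitz_continuous _ _ 2) => a b; have [] := lipPQ i a b.
Qed.

Let cont_u i x : {for x, continuous (fun x => u x i)}.
Proof. by have [cP cQ] := contPQ i x; exact: cvgB cQ cP. Qed.

Let cont_m i x : {for x, continuous (fun x => m x i)}.
Proof.
have [cP _] := contPQ i x; apply: cvgD cP _.
by apply: cvgMl; exact: cont_u.
Qed.

Let f x y := dot (u x) (u y).
Let h x y := dot (fun i => m x i - m y i) (cross (u x) (u y)).

Let fst_cont (k : R -> R) (p : R * R) : {for p.1, continuous k} -> {for p, continuous (fun p : R * R => k p.1)}.
Proof. by move=> kc; exact: (continuous_comp (@cvg_fst _ _ _ _ _) kc). Qed.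

Let snd_cont (k : R -> R) (p : R * R) : {for p.2, continuous k} -> {for p, continuous (fun p : R * R => k p.2)}.
Proof. by move=> kc; exact: (continuous_comp (@cvg_snd _ _ _ _ _) kc). Qed.

Let fcont (p : R * R) : {for p, continuous (fun p : R * R => f p.1 p.2)}.
Proof.
have -> : (fun p : R * R => f p.1 p.2) =
    (fun p => u p.1 0 * u p.2 0 + u p.1 1 * u p.2 1 + u p.1 2 * u p.2 2).
  by apply/funext => q; rewrite /f dotE.
have U1 i : {for p, continuous (fun p : R * R => u p.1 i)} by apply: (fst_cont (k := fun x => u x i)); exact: cont_u.
have U2 i : {for p, continuous (fun p : R * R => u p.2 i)} by apply: (snd_cont (k := fun x => u x i)); exact: cont_u.
by apply: cvgD; [apply: cvgD|]; apply: cvgM; [exact: U1|exact: U2|exact: U1|exact: U2|exact: U1|exact: U2].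
Qed.

Let hcont (p : R * R) : {for p, continuous (fun p : R * R => h p.1 p.2)}.
Proof.
have -> : (fun p : R * R => h p.1 p.2) =
    (fun p => (m p.1 0 - m p.2 0) * (u p.1 1 * u p.2 2 - u p.1 2 * u p.2 1) +
              (m p.1 1 - m p.2 1) * (u p.1 2 * u p.2 0 - u p.1 0 * u p.2 2) +
              (m p.1 2 - m p.2 2) * (u p.1 0 * u p.2 1 - u p.1 1 * u p.2 0)).
  by apply/funext => q; rewrite /h dotE !crossE.
have U1 i : {for p, continuous (fun p : R * R => u p.1 i)} by apply: (fst_cont (k := fun x => u x i)); exact: cont_u.
have U2 i : {for p, continuous (fun p : R * R => u p.2 i)} by apply: (snd_cont (k := fun x => u x i)); exact: cont_u.
have M i : {for p, continuous (fun p : R * R => m p.1 i - m p.2 i)}.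
  apply: cvgB; [apply: (fst_cont (k := fun x => m x i))|apply: (snd_cont (k := fun x => m x i))];
  exact: cont_m.
have W i j : {for p, continuous (fun p : R * R => u p.1 i * u p.2 j - u p.1 j * u p.2 i)}.
  by apply: cvgB; apply: cvgM; [exact: U1|exact: U2|exact: U1|exact: U2].
by apply: cvgD; [apply: cvgD|]; apply: cvgM; [exact: M|exact: W|exact: M|exact: W|exact: M|exact: W].
Qed.

Let perpendicular_pair : exists x y, [/\ x < y, y < x + lam, f x y = 0 & h x y = 0].
Proof.
have fanti x y : f x (y + lam) = - f x y.
  by rewrite /f !dotE !uD; ring.
have hanti x y : h x (y + lam) = - h x y.
  by rewrite /h !dotE !crossE !mD !uD; ring.
have fsym x y : f x y = f y x by exact: dotC.
have hsym x y : h x y = h y x by rewrite /h !dotE !crossE; ring.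
have fdiag x : 0 < f x x by rewrite /f (bendE x).1; have := sqr_ge0 (t x); lra.
have hdiag x : h x x = 0 by rewrite /h !dotE !subrr; ring.
have [x [y [x0 xy yl fxy hxy]]] :=
  symmetric_common_zero lam0 fcont hcont fsym hsym fanti hanti fdiag hdiag.
exists x, y; split => //.
  rewrite lt_neqAle xy andbT; apply/eqP => E.
  by have := fdiag x; rewrite {2}E fxy ltxx.
rewrite lt_neqAle; apply/andP; split; last by lra.
apply/eqP => E; have := fanti x x; rewrite -E fxy => /esym/eqP; rewrite oppr_eq0 => /eqP F0.
by have := fdiag x; rewrite F0 ltxx.
Qed.

Let turn x (k : int) : t (x + k%:~R * lam) = if odd `|k|%N then - t x else t x.
Proof.
have N (n : nat) z : t (z + n%:R * lam) = if odd n then - t z else t z.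
  elim: n z => [|n IH] z; first by rewrite mul0r addr0.
  by rewrite -natr1 mulrDl mul1r addrA tanti IH /=; case: (odd n); rewrite ?opprK.
case: k => n; first by rewrite -pmulrn N absz_nat.
have := N n.+1 (x + (Negz n)%:~R * lam).
rewrite NegzE mulrNz -pmulrn -addrA mulNr addNr addr0 abszN absz_nat => ->.
by case: (odd _); rewrite ?opprK.
Qed.

(** Embeddedness makes a common point of the segments come from points related by [k] gluings. The
    heights give [be = al] or [be = - al], and the bends at [y] and [x + k lam] share a point, so
    they coincide and [0 < k < 1]. *)
Let no_crossing x y al be : x < y -> y < x + lam ->
  (forall i, m x i + al * u x i = m y i + be * u y i) ->
  `|al| <= 2^-1 -> `|be| <= 2^-1 -> (`|al| < 2^-1) || (`|be| < 2^-1) -> False.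
Proof.
move=> xy yx E al1 be1 ab.
have H z c i : `|c| <= 2^-1 -> m z i + c * u z i = g i (z + t z * c, c + 2^-1).
  rewrite ler_norml => c1; have := (bendE z).2 i (c + 2^-1); rewrite addrK => ->; last by lra.
  by rewrite /m; ring.
have [] := emb (p := (x + t x * al, al + 2^-1)) (q := (y + t y * be, be + 2^-1)).
- by move: al1; rewrite /= ler_norml; lra.
- by move: be1; rewrite /= ler_norml; lra.
- by move=> i; rewrite -!H.
move=> k /= [E1 E2].
have abE : be = if odd `|k|%N then - al else al by move: E2; case: (odd _); lra.
have nab : `|be| = `|al| by rewrite abE; case: (odd _); rewrite ?normrN.
have be2 : `|be| < 2^-1 by move: ab; rewrite nab orbb.
pose z := x + k%:~R * lam.
have E3 : y - z = (t z - t y) * be.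
  have : y + t y * be = z + t z * be.
    rewrite E1 /z turn abE; case: (odd _); ring.
  by rewrite mulrBl; lra.
(* Two bends of a 2-Lipschitz family meet only at the boundary, where [|be| = 2^-1]. *)
have yz : y = z.
  apply/eqP; rewrite -subr_eq0 -normr_le0 leNgt; apply/negP => d0.
  have : `|y - z| <= (2 * `|z - y|) * `|be| by rewrite E3 normrM ler_wpM2r// -E3.
  have : `|y - z| * `|be| < `|y - z| * 2^-1 by rewrite ltr_pM2l.
  by rewrite [`|z - y|]distrC; lra.
rewrite yz /z in xy yx.
have : 0 < k%:~R * lam by lra.
have : k%:~R * lam < 1 * lam by rewrite mul1r; lra.
by rewrite ltr_pM2r// pmulr_lgt0// ltr0z ltrz1 gtz0_ge1 ltNge => /negPf->.
Qed.

(** The chords [P x], [P y], [P (x + lam) = Q x] are no longer than the boundary arcs, of total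
    length [lam + t x]; the chords through [Q y] similarly give [lam - t x]. *)
Let half_pattern x y al be : x < y -> y < x + lam -> f x y = 0 ->
  (forall i, m x i - m y i = - al * u x i + be * u y i) ->
  2^-1 <= `|be| -> (`|be| = 2^-1 -> 2^-1 <= `|al|) -> 3 < lam ^+ 2.
Proof.
move=> xy yx fxy D.
have pyth (v : 'I_3 -> R) c e : (forall i, v i = c * u x i + e * u y i) ->
    dot v v = c ^+ 2 * (1 + t x ^+ 2) + e ^+ 2 * (1 + t y ^+ 2).
  move=> vE; rewrite -(bendE x).1 -(bendE y).1.
  transitivity (c ^+ 2 * dot (u x) (u x) + e ^+ 2 * dot (u y) (u y) + 2 * c * e * dot (u x) (u y)).
    by rewrite !dotE !vE; ring.
  by rewrite -/(f x y) fxy mulr0 addr0.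
have mP z i : P z i = m z i - u z i / 2 by rewrite /m; ring.
have mQ z i : Q z i = m z i + u z i / 2 by rewrite /m /u; field.
have B1 : 1 <= 1 + t y ^+ 2 by have := sqr_ge0 (t y); lra.
have [xy' yx'] := (ltW xy, ltW yx).
have d1 := monoP xy'; have d2 := monoP yx'; have d3 := monoQ xy'; have d4 := monoQ yx'.
apply: (T_pattern_bound (t := t x) (al := al) (be := be) B1 d1 d2 d3 d4).
- have := hlip (x - t x / 2) (y - t y / 2) I0.
  rewrite (pyth _ (al + 2^-1) (- (be + 2^-1))) ?sqrrN// => i.
  rewrite -/(P x i) -/(P y i) !mP.
  have -> : m x i = m y i + (m x i - m y i) by ring.
  by rewrite D; field.
- have := hlip (y - t y / 2) (x + lam - t (x + lam) / 2) I0.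
  rewrite (pyth _ (- (al - 2^-1)) (be + 2^-1)) ?sqrrN// => i.
  rewrite -/(P (x + lam) i) -/(P y i) PD mP mQ.
  have -> : m x i = m y i + (m x i - m y i) by ring.
  by rewrite D; field.
- have := hlip (x + t x / 2) (y + t y / 2) I1.
  rewrite (pyth _ (al - 2^-1) (- (be - 2^-1))) ?sqrrN// => i.
  rewrite -/(Q x i) -/(Q y i) !mQ.
  have -> : m x i = m y i + (m x i - m y i) by ring.
  by rewrite D; field.
- have := hlip (y + t y / 2) (x + lam + t (x + lam) / 2) I1.
  rewrite (pyth _ (- (al + 2^-1)) (be - 2^-1)) ?sqrrN// => i.
  rewrite -/(Q (x + lam) i) -/(Q y i) QD mP mQ.
  have -> : m x i = m y i + (m x i - m y i) by ring.
  by rewrite D; field.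
- by rewrite tanti; field.
- by rewrite tanti; field.
Qed.

Lemma bend_family_bound : 3 < lam ^+ 2.
Proof.
have [x [y [xy yx fxy hxy]]] := perpendicular_pair.
have A0 z : 0 < dot (u z) (u z) by rewrite (bendE z).1; have := sqr_ge0 (t z); lra.
pose D i := m x i - m y i.
(* The lines of the two bends meet at parameter [al] on the first and [be] on the second, measured
   from the midpoints. *)
pose al := - (dot D (u x) / dot (u x) (u x)); pose be := dot D (u y) / dot (u y) (u y).
have DE i : m x i - m y i = - al * u x i + be * u y i.
  apply/eqP; rewrite -subr_eq0; apply/eqP; move: i.
  have Ax := lt0r_neq0 (A0 x); have Ay := lt0r_neq0 (A0 y).
  apply: (@orthogonal_zero _ (fun i => D i - (- al * u x i + be * u y i)) (u x) (u y)) => //.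
  - transitivity (dot D (u x) - (- al * dot (u x) (u x) + be * dot (u x) (u y))).
      by rewrite !dotE; ring.
    by rewrite -/(f x y) fxy /al opprK divfK// mulr0 addr0 subrr.
  - transitivity (dot D (u y) - (- al * dot (u x) (u y) + be * dot (u y) (u y))).
      by rewrite !dotE; ring.
    by rewrite -/(f x y) fxy /be divfK// mulr0 add0r subrr.
  - by rewrite -[RHS]hxy /h !dotE !crossE /D; ring.
have meet i : m x i + al * u x i = m y i + be * u y i.
  by rewrite -[m x i](subrK (m y i)) DE; ring.
have nc := no_crossing xy yx meet.
have [bh|bl] := leP 2^-1 `|be|.
  apply: (half_pattern xy yx fxy DE bh) => be2; rewrite leNgt; apply/negP => al2.
  by apply: nc; [exact: ltW | rewrite be2 | rewrite al2].
(* Now the bend at [y] is the base. The other is taken at [x + lam], where [u] has the opposite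
   sign, whence [- al]. *)
apply: (@half_pattern y (x + lam) be (- al)) => //.
- by rewrite ltrD2r.
- by rewrite /f dotC dotE !uD !mulNr -!opprD -dotE -/(f x y) fxy oppr0.
- by move=> i; rewrite mD uD -opprB DE; ring.
- rewrite normrN leNgt; apply/negP => al2.
  by apply: nc; [exact: ltW | exact: ltW | rewrite al2].
- rewrite normrN => al2; rewrite leNgt; apply/negP => be2.
  by apply: nc; [rewrite al2 | exact: ltW | rewrite bl orbT].
Qed.

End BendFamily.

(** * Smooth paper Moebius bands *)

Section PaperMoebius.
Context {R : realType} (lam : R) (G : R * R -> 'rV[R]_3).
Hypothesis pm : smooth_paper_moebius lam G.
Let U : set (R * R) := [set p | 0 < p.2 < 1].
Let g : 'I_3 -> R * R -> R := fun i p => G p 0 i.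

(** After intersection with the open strip, [H] and [G] agree on an open set and so have the same
    derivatives there. *)
Let open_chart p : U p -> exists (W : set (R * R)) (H : R * R -> 'rV[R]_3),
  [/\ open W, W p, W `<=` U, smooth_on W H &
   forall q, W q -> H q = G q /\
     [/\ dot3 ('D_e1 H q) ('D_e1 H q) = 1, dot3 ('D_e2 H q) ('D_e2 H q) = 1 &
         dot3 ('D_e1 H q) ('D_e2 H q) = 0]].
Proof.
move=> Up; have sU q : U q -> strip q by rewrite /U /strip /= => /andP[? ?]; rewrite !ltW.
have [V [H [oV Vp sH HG iso]]] := pm.2 p (sU p Up).
exists (V `&` U), H; split.
- by apply: openI => //; exact: open_strip.
- by split.
- by move=> q [].
- by move=> k; apply: Ck_sub (sH k) => q [].
- by move=> q [Vq Uq]; split; [apply: HG => //; exact: sU | apply: iso => //; exact: sU].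
Qed.

Lemma smooth_paper : forall i, smooth_on U (g i).
Proof.
move=> i k; apply: Ck_coord; first exact: open_strip.
apply: Ck_local => p Up; have [W [H [oW Wp _ sH HG]]] := open_chart Up.
exists W; split => //; apply: Ck_ext oW _ (sH k) => q Wq; exact: (HG q Wq).1.
Qed.

Lemma paper_metric p : U p ->
  [/\ dot (fun i => 'D_e1 (g i) p) (fun i => 'D_e1 (g i) p) = 1,
      dot (fun i => 'D_e2 (g i) p) (fun i => 'D_e2 (g i) p) = 1 &
      dot (fun i => 'D_e1 (g i) p) (fun i => 'D_e2 (g i) p) = 0].
Proof.
move=> Up; have [W [H [oW Wp _ sH HG]]] := open_chart Up.
have E q : W q -> H q = G q by move=> /HG[].
have [_ [dH _]] := sH 1%N; have [dH1 dH2] := dH p Wp.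
have N := near_eq_open oW E Wp.
have D v : derivable H p v -> forall i, 'D_v (g i) p = 'D_v H p 0 i.
  move=> dv i.
  have dG : derivable G p v by exact: near_eq_derivable N dv.
  have -> : 'D_v H p = 'D_v G p by exact: near_eq_derive N.
  by rewrite (derive_mx dG) mxE.
have [_ [i1 i2 i3]] := HG p Wp.
split.
- exact: etrans (etrans (dot_congrl _ (D e1 dH1)) (dot_congrr _ (D e1 dH1))) i1.
- exact: etrans (etrans (dot_congrl _ (D e2 dH2)) (dot_congrr _ (D e2 dH2))) i2.
- exact: etrans (etrans (dot_congrl _ (D e1 dH1)) (dot_congrr _ (D e2 dH2))) i3.
Qed.

(** Continuity is relative to the closed strip, since the values of [G] off it are arbitrary. *)
Lemma paper_continuous i (p : R * R) : 0 <= p.2 <= 1 ->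
  g i @ within [set q : R * R | 0 <= q.2 <= 1] (nbhs p) --> g i p.
Proof.
move=> sp; have [V [H [oV Vp sH HG _]]] := pm.2 p sp.
have cH : {for p, continuous (fun q => H q 0 i)}.
  exact: (continuous_comp (sH 0%N p Vp) (@coord_continuous _ _ _ 0 i (H p))).
move=> A; rewrite /g -(HG p Vp sp) => /cH nA.
have N : nbhs p (V `&` (fun q => A (H q 0 i))).
  by apply: filterI => //; exact: open_nbhs_nbhs.
change (nbhs p (fun q : R * R => 0 <= q.2 <= 1 -> A (G q 0 i))).
by apply: filterS N => q [Vq Aq] sq; rewrite -HG.
Qed.

End PaperMoebius.

Theorem mainTheorem1 (R : realType) (lam : R) (G : R * R -> 'rV[R]_3) :
  0 < lam -> smooth_paper_moebius lam G -> moeb_embedded lam G ->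
  Num.sqrt 3 < lam.
Proof.
move=> lam0 pm emb.
pose g : 'I_3 -> R * R -> R := fun i p => G p 0 i.
have sg := smooth_paper pm.
have iso := paper_metric pm.
have D11 p Up := let: And3 H _ _ := iso p Up in H.
have D22 p Up := let: And3 _ H _ := iso p Up in H.
have D12 p Up := let: And3 _ _ H := iso p Up in H.
have deck i (x y : R) : 0 <= y <= 1 -> g i (x + lam, y) = g i (x, 1 - y).
  by move=> yI; rewrite /g pm.1.
have [t [tlip tanti D0]] := bend_family lam0 sg D11 D22 D12 deck.
have bend x := bend_affine sg D11 D22 D12 (paper_continuous pm) (D0 x).
have hlip y x x' := @horizontal_lipschitz _ _ sg D11 (paper_continuous pm) y x x'.
have embG (p q : R * R) : 0 <= p.2 <= 1 -> 0 <= q.2 <= 1 ->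
    (forall i, g i p = g i q) -> moeb_rel lam p q.
  by move=> sp sq E; apply: emb => //; apply/rowP => i; exact: E.
have := bend_family_bound lam0 tlip tanti bend hlip deck embG.
by move=> H; rewrite -(ger0_norm (ltW lam0)) -sqrtr_sqr ltr_sqrt// exprn_gt0.
Qed.
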